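(* Let $n$ be a positive integer, let $q$ be a nonzero complex number, let $K$ be a field containing $q$, and let $\mathfrak{h}_n(q)$ be the $q$-Heisenberg algebra over $K$, equipped with the natural $\mathbb{N}$-grading where $\deg(x_i)=\deg(y_i)=\deg(z_i)=1$. Then its Hilbert series is $$H_{\mathfrak{h}_n(q)}(t)=\sum_{d\ge0}\dim_K\mathfrak{h}_n(q)_d\,t^d=\frac{1}{(1-t)^{3n}}.$$ Consequently, $\mathfrak{h}_n(q)$ has polynomial growth of degree $3n$, and its Gelfand–Kirillov dimension coincides with its classical Krull dimension.
   Context: The $q$-Heisenberg algebra $\mathfrak{h}_n(q)$ is the unital associative $K$-algebra generated by $x_i,y_i,z_i$ ($1\le i\le n$) subject to the relations: $x_ix_j=x_jx_i$, $y_iy_j=y_jy_i$, $z_iz_j=z_jz_i$ for $1\le i<j\le n$; $x_iz_i=q\,z_ix_i$, $y_iz_i=q^{-1}z_iy_i$, $x_iy_i=q^{-1}y_ix_i+z_i$ for $1\le i\le n$; and $x_iy_j=y_jx_i$, $x_iz_j=z_jx_i$, $y_iz_j=z_jy_i$ for $i\ne j$. It has the PBW $K$-basis consisting of the monomials $z_1^{a_1}\cdots z_n^{a_n}y_1^{b_1}\cdots y_n^{b_n}x_1^{c_1}\cdots x_n^{c_n}$ with $a_i,b_i,c_i\in\mathbb{N}$. For $d\ge0$, $\mathfrak{h}_n(q)_d$ denotes the $K$-span of the PBW monomials of total degree $\sum_i(a_i+b_i+c_i)=d$, so that $\mathfrak{h}_n(q)=\bigoplus_{d\ge0}\mathfrak{h}_n(q)_d$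 as a vector space. Polynomial growth of degree $3n$ means that $\dim_K\bigoplus_{d\le N}\mathfrak{h}_n(q)_d$ grows like a polynomial in $N$ of degree $3n$. The Gelfand–Kirillov dimension of a finitely generated algebra $A$ is $\limsup_{d\to\infty}\log(\dim V^d)/\log d$, where $V$ is a finite-dimensional generating subspace (containing $1$). The classical Krull dimension is the supremum of the lengths of chains of prime (two-sided) ideals. *)

(* Defs.v *)
From HB Require Import structures.
From mathcomp Require Import all_boot all_order all_algebra.
From mathcomp Require Import boolp classical_sets.
(* [monalg] is imported only inside [Presentation]: its notations are
   incompatible with those of MathComp-Analysis. *)
From mathcomp Require finmap monalg.

Set Implicit Arguments.
Unset Strict Implicit.
Unset Printing Implicit Defensive.

Import Order.TTheory GRing.Theory Num.Theory.
Local Open Scope classical_set_scope.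
Local Open Scope ring_scope.

Section TwoSidedIdeal.
Variable R : nzRingType.

Definition ideal_gen (S : set R) : set R :=
  [set r | exists (m : nat) (a s b : 'I_m -> R),
     (forall i, S (s i)) /\ r = \sum_i a i * s i * b i].

Lemma ideal_gen0 S : ideal_gen S 0.
Proof.
exists 0%N, (fun=> 0), (fun=> 0), (fun=> 0).
by split=> [[]//|]; rewrite big_ord0.
Qed.

Lemma ideal_genMlr S c d r : ideal_gen S r -> ideal_gen S (c * r * d).
Proof.
move=> [m [a [s [b [Ss ->]]]]].
exists m, (fun i => c * a i), s, (fun i => b i * d); split=> //.
by rewrite mulr_sumr mulr_suml; apply: eq_bigr => i _; rewrite !mulrA.
Qed.

Lemma ideal_genD S r1 r2 :
  ideal_gen S r1 -> ideal_gen S r2 -> ideal_gen S (r1 + r2).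
Proof.
move=> [m1 [a1 [s1 [b1 [S1 ->]]]]] [m2 [a2 [s2 [b2 [S2 ->]]]]].
pose glue (f : 'I_m1 -> R) (g : 'I_m2 -> R) (i : 'I_(m1 + m2)) :=
  match split i with inl j => f j | inr j => g j end.
exists (m1 + m2)%N, (glue a1 a2), (glue s1 s2), (glue b1 b2); split.
  by move=> i; rewrite /glue; case: (split i).
rewrite big_split_ord /=; congr (_ + _); apply: eq_bigr => i _; rewrite /glue.
  by rewrite (unsplitK (inl i)).
by rewrite (unsplitK (inr i)).
Qed.

Lemma ideal_genMl S c r : ideal_gen S r -> ideal_gen S (c * r).
Proof. by move=> /(ideal_genMlr c 1); rewrite mulr1. Qed.

Lemma ideal_genMr S d r : ideal_gen S r -> ideal_gen S (r * d).
Proof. by move=> /(ideal_genMlr 1 d); rewrite mul1r. Qed.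

Definition ideal_pred (S : set R) : {pred R} := [pred r | `[< ideal_gen S r >]].

Lemma ideal_predP S r : reflect (ideal_gen S r) (r \in ideal_pred S).
Proof. exact: asboolP. Qed.

Fact ideal_pred_zmod_closed S : zmod_closed (ideal_pred S).
Proof.
split=> [|u v /ideal_predP Iu /ideal_predP Iv]; apply/ideal_predP.
  exact: ideal_gen0.
by apply: ideal_genD => //; rewrite -mulN1r; apply: ideal_genMl.
Qed.
HB.instance Definition _ S :=
  GRing.isZmodClosed.Build R (ideal_pred S) (ideal_pred_zmod_closed S).

End TwoSidedIdeal.

(* The defining relations [lhs = rhs] of the q-Heisenberg algebra, each one
   as the element [lhs - rhs]. *)
Definition heis_relators (K : fieldType) (A : lalgType K) (n : nat) (q : K)
    (x y z : 'I_n -> A) : set A :=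
  [set r | exists i j : 'I_n, (i < j)%N /\
     [\/ r = x i * x j - x j * x i,
         r = y i * y j - y j * y i
       | r = z i * z j - z j * z i]] `|`
  [set r | exists i : 'I_n,
     [\/ r = x i * z i - q *: (z i * x i),
         r = y i * z i - q^-1 *: (z i * y i)
       | r = x i * y i - (q^-1 *: (y i * x i) + z i)]] `|`
  [set r | exists i j : 'I_n, i != j /\
     [\/ r = x i * y j - y j * x i,
         r = x i * z j - z j * x i
       | r = y i * z j - z j * y i]].

Lemma heis_relators_aug0 (K : fieldType) (A : lalgType K) (n : nat) (q : K)
    (x y z : 'I_n -> A) (aug : A -> K) :
    {morph aug : u v / u * v} -> {morph aug : u v / u - v} ->
    {morph aug : u v / u + v} -> (forall k u, aug (k *: u) = k * aug u) ->
    (forall i, aug (x i) = 0) -> (forall i, aug (y i) = 0) ->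
    (forall i, aug (z i) = 0) ->
  forall r, heis_relators q x y z r -> aug r = 0.
Proof.
move=> augM augB augD augZ augx augy augz r.
by case=> [[|]|] => -[j]; [case=> l [_]| |case=> l [_]]; case=> ->;
  rewrite augB ?augD ?augZ !augM !(augx, augy, augz) !(mul0r, mulr0) ?addr0 subr0.
Qed.

Section Presentation.
Import monalg.
Local Notation words n := {fmonom ('I_n + 'I_n + 'I_n)%type}.
Variables (K : fieldType) (n : nat).

(* Generators: [inl (inl i)] is x_i, [inl (inr i)] is y_i, [inr i] is z_i. *)
Definition free_alg := {malg K[words n]}.
HB.instance Definition _ := GRing.Lalgebra.on free_alg.

Definition freex (i : 'I_n) : free_alg := << fmu (inl (inl i)) >>.
Definition freey (i : 'I_n) : free_alg := << fmu (inl (inr i)) >>.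
Definition freez (i : 'I_n) : free_alg := << fmu (inr i) >>.

Fact free_scalerAr (k : K) (u v : free_alg) : k *: (u * v) = u * (k *: v).
Proof.
apply/malgP => m; rewrite mcoeffZ.
rewrite (mcoeffMlw m (finmap.fsubset_refl _) (finmap.fsubset_refl _)).
rewrite (mcoeffMlw m (finmap.fsubset_refl _) (msuppZ_le k v)).
rewrite mulr_sumr; apply: eq_bigr => m1 _; rewrite mulr_sumr.
by apply: eq_bigr => m2 _; rewrite mcoeffZ mulrnAr mulrCA.
Qed.

Variable q : K.

Definition heis_ideal := ideal_pred (heis_relators q freex freey freez).

(* The augmentation sending every generator to 0 kills the relators. *)
Fact heis_ideal1 : 1 \notin heis_ideal.
Proof.
pose aug : free_alg -> K := @mcoeff (words n) K mone.
have augM u v : aug (u * v) = aug u * aug v.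
  by apply: (rmorphM (@mcoeff (words n) K mone)).
have aug1 : aug 1 = 1 by apply: (rmorph1 (@mcoeff (words n) K mone)).
have aug_sum m (f : 'I_m -> free_alg) : aug (\sum_i f i) = \sum_i aug (f i).
  exact: raddf_sum.
have augB u v : aug (u - v) = aug u - aug v by apply: raddfB.
have augD u v : aug (u + v) = aug u + aug v by apply: raddfD.
have augZ k u : aug (k *: u) = k * aug u by apply: mcoeffZ.
have aug_gen g : aug << fmu g >> = 0.
  rewrite /aug mcoeffU; case: eqP => // /(congr1 (@fdeg _)).
  by rewrite fdegU fdeg1.
have augx i : aug (freex i) = 0 by apply: aug_gen.
have augy i : aug (freey i) = 0 by apply: aug_gen.
have augz i : aug (freez i) = 0 by apply: aug_gen.
apply/negP => /ideal_predP[m [a [s [b [Ss]]]]] /(congr1 aug).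
rewrite aug1 aug_sum big1 => [/eqP|i _]; first by rewrite oner_eq0.
rewrite !augM; suff -> : aug (s i) = 0 by rewrite mulr0 mul0r.
exact: (heis_relators_aug0 augM augB augD augZ augx augy augz (Ss i)).
Qed.

Definition heis := Quotient.quot heis_ideal.

HB.instance Definition _ := Choice.on heis.
HB.instance Definition _ := EqQuotient.on heis.
HB.instance Definition _ := GRing.Zmodule.on heis.
HB.instance Definition _ := ZmodQuotient.on heis.

Local Open Scope quotient_scope.

Definition heis_proj (u : free_alg) : heis := \pi_heis u.

Lemma heis_proj_eqP u v :
  reflect (heis_proj u = heis_proj v) (u - v \in heis_ideal).
Proof. by rewrite Quotient.idealrBE; apply: eqP. Qed.

Lemma heis_projK (a : heis) : heis_proj (repr a) = a.
Proof. exact: reprK. Qed.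

Lemma repr_heis_proj u : repr (heis_proj u) - u \in heis_ideal.
Proof. by apply/heis_proj_eqP; rewrite heis_projK. Qed.

Definition heis_one := heis_proj 1.
Definition heis_mul (a b : heis) := heis_proj (repr a * repr b).
Definition heis_scale (k : K) (a : heis) := heis_proj (k *: repr a).

Lemma heis_projD u v : heis_proj (u + v) = heis_proj u + heis_proj v.
Proof. exact: raddfD. Qed.

Lemma heis_projM u v : heis_proj (u * v) = heis_mul (heis_proj u) (heis_proj v).
Proof.
apply/esym/heis_proj_eqP; set u' := repr _; set v' := repr _.
have -> : u' * v' - u * v = u' * (v' - v) + (u' - u) * v.
  by rewrite mulrBr mulrBl addrA subrK.
apply: rpredD; apply/ideal_predP.
  by apply: ideal_genMl; apply/ideal_predP/repr_heis_proj.
by apply: ideal_genMr; apply/ideal_predP/repr_heis_proj.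
Qed.

Lemma heis_projZ k u : heis_proj (k *: u) = heis_scale k (heis_proj u).
Proof.
apply/esym/heis_proj_eqP; rewrite -scalerBr -[_ - _]mul1r scalerAl.
by apply/ideal_predP/ideal_genMl/ideal_predP/repr_heis_proj.
Qed.

Fact heis_mulA : associative heis_mul.
Proof.
move=> a b c; rewrite -(heis_projK a) -(heis_projK b) -(heis_projK c).
by rewrite -!heis_projM mulrA.
Qed.
Fact heis_mul1 : left_id heis_one heis_mul.
Proof. by move=> a; rewrite -(heis_projK a) -heis_projM mul1r. Qed.
Fact heis_mulr1 : right_id heis_one heis_mul.
Proof. by move=> a; rewrite -(heis_projK a) -heis_projM mulr1. Qed.
Fact heis_mulDl : left_distributive heis_mul +%R.
Proof.
move=> a b c; rewrite -(heis_projK a) -(heis_projK b) -(heis_projK c).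
by rewrite -heis_projD -!heis_projM -heis_projD mulrDl.
Qed.
Fact heis_mulDr : right_distributive heis_mul +%R.
Proof.
move=> a b c; rewrite -(heis_projK a) -(heis_projK b) -(heis_projK c).
by rewrite -heis_projD -!heis_projM -heis_projD mulrDr.
Qed.
Fact heis_one_neq0 : heis_one != 0.
Proof.
rewrite -[0 as X in _ != X](raddf0 (\pi_heis : free_alg -> heis)).
by apply/negP => /eqP/heis_proj_eqP; rewrite subr0 (negbTE heis_ideal1).
Qed.
HB.instance Definition _ := GRing.Zmodule_isNzRing.Build heis
  heis_mulA heis_mul1 heis_mulr1 heis_mulDl heis_mulDr heis_one_neq0.

Fact heis_scaleA k l a : heis_scale k (heis_scale l a) = heis_scale (k * l) a.
Proof. by rewrite -(heis_projK a) -!heis_projZ scalerA. Qed.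
Fact heis_scale1 : left_id 1 heis_scale.
Proof. by move=> a; rewrite -(heis_projK a) -heis_projZ scale1r. Qed.
Fact heis_scaleDr : right_distributive heis_scale +%R.
Proof.
move=> k a b; rewrite -(heis_projK a) -(heis_projK b).
by rewrite -heis_projD -!heis_projZ -heis_projD scalerDr.
Qed.
Fact heis_scaleDl a : {morph heis_scale^~ a : k l / k + l}.
Proof.
by move=> k l; rewrite -(heis_projK a) -!heis_projZ -heis_projD scalerDl.
Qed.
HB.instance Definition _ := GRing.Zmodule_isLmodule.Build K heis
  heis_scaleA heis_scale1 heis_scaleDr heis_scaleDl.

Fact heis_scaleAl (k : K) (a b : heis) : k *: (a * b) = k *: a * b.
Proof.
rewrite -(heis_projK a) -(heis_projK b) -[LHS]/(heis_scale k (heis_mul _ _)).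
rewrite -[RHS]/(heis_mul (heis_scale k _) _).
by rewrite -heis_projM -!heis_projZ -heis_projM scalerAl.
Qed.
HB.instance Definition _ := GRing.Lmodule_isLalgebra.Build K heis heis_scaleAl.

Fact heis_scaleAr (k : K) (a b : heis) : k *: (a * b) = a * (k *: b).
Proof.
rewrite -(heis_projK a) -(heis_projK b) -[LHS]/(heis_scale k (heis_mul _ _)).
rewrite -[RHS]/(heis_mul _ (heis_scale k _)).
by rewrite -heis_projM -!heis_projZ -heis_projM free_scalerAr.
Qed.
HB.instance Definition _ := GRing.Lalgebra_isAlgebra.Build K heis heis_scaleAr.

Definition heisx (i : 'I_n) : heis := heis_proj (freex i).
Definition heisy (i : 'I_n) : heis := heis_proj (freey i).
Definition heisz (i : 'I_n) : heis := heis_proj (freez i).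

End Presentation.

From mathcomp Require Import complex reals ereal topology normedtype sequences.
From mathcomp Require Import exp.
Import numFieldNormedType.Exports.

(* The field K contains the complex number q, qK being q seen in K: some
   common subfield F of C = R[i] and K contains q. *)
Definition contains_complex (R : realType) (q : R[i]) (K : fieldType) (qK : K)
    : Prop :=
  exists (F : fieldType) (inC : {rmorphism F -> R[i]}) (inK : {rmorphism F -> K}),
  exists2 a : F, inC a = q & inK a = qK.

Section Dimension.
Variables (K : fieldType) (V : lmodType K).

Definition lspan (S : set V) : set V :=
  [set v | exists (m : nat) (c : 'I_m -> K) (s : 'I_m -> V),
     (forall i, S (s i)) /\ v = \sum_i c i *: s i].

Definition is_basis (U : set V) (m : nat) (b : 'I_m -> V) : Prop :=
  lspan (range b) = U /\
  (forall c : 'I_m -> K, \sum_i c i *: b i = 0 -> forall i, c i = 0).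

Definition fin_ldim (U : set V) : Prop :=
  exists (m : nat) (b : 'I_m -> V), is_basis U b.

(* Meaningful only when [fin_ldim U]; junk value 0 otherwise. *)
Definition ldim (U : set V) : nat :=
  xget 0%N [set m | exists b : 'I_m -> V, is_basis U b].

End Dimension.

Section HeisenbergGrading.
Variables (K : fieldType) (n : nat) (q : K).

Definition pbw_monomial (a b c : 'I_n -> nat) : heis n q :=
  (\prod_i heisz q i ^+ a i) * (\prod_i heisy q i ^+ b i) *
  (\prod_i heisx q i ^+ c i).

Definition heis_component (d : nat) : set (heis n q) :=
  lspan [set m | exists a b c : 'I_n -> nat,
    (\sum_i (a i + b i + c i))%N = d /\ m = pbw_monomial a b c].

Definition heis_upto (N : nat) : set (heis n q) :=
  [set v | exists u : 'I_N.+1 -> heis n q,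
     (forall d : 'I_N.+1, heis_component d (u d)) /\ v = \sum_d u d].

End HeisenbergGrading.
Arguments heis_component {K} n q d.
Arguments heis_upto {K} n q N.

(* Formal power series over Z, as coefficient sequences. *)
Definition fps := nat -> int.
Definition fps_mul (f g : fps) : fps :=
  fun d => \sum_(i < d.+1) f i * g (d - i)%N.
Definition fps_of_poly (p : {poly int}) : fps := fun d => p`_d.

Definition hilbert_series (K : fieldType) (n : nat) (q : K) : fps :=
  fun d => (ldim (heis_component n q d))%:Z.
Arguments hilbert_series {K} n q d.

Definition grows_like_poly (R : realType) (f : nat -> nat) (m : nat) : Prop :=
  exists p : {poly R}, size p = m.+1 /\
    ((f N)%:R / p.[N%:R] : R) @[N --> \oo] --> (1 : R).

Section AlgebraDimensions.
Variables (R : realType) (K : fieldType) (A : algType K).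

Fixpoint subspace_pow (V : set A) (d : nat) : set A :=
  if d is e.+1 then
    lspan [set w | exists u v, V u /\ subspace_pow V e v /\ w = u * v]
  else lspan [set 1].

Definition generating_subspace (V : set A) : Prop :=
  [/\ fin_ldim V, V 1 &
      forall S : {pred A}, subalg_closed S ->
        (forall v, V v -> v \in S) -> forall a, a \in S].

Definition growth_exponent (V : set A) : \bar R :=
  limn_esup (fun d : nat =>
    (ln (ldim (subspace_pow V d))%:R / ln d%:R : R)%:E).

(* g is the Gelfand-Kirillov dimension of the finitely generated algebra A:
   the value below does not depend on V. *)
Definition is_GKdim (g : \bar R) : Prop :=
  (exists V, generating_subspace V) /\
  forall V, generating_subspace V -> growth_exponent V = g.

Definition two_sided_ideal (I : set A) : Prop :=
  [/\ I 0, forall a b, I a -> I b -> I (a + b)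
    & forall a r b, I r -> I (a * r * b)].

Definition prime_ideal (P : set A) : Prop :=
  [/\ two_sided_ideal P, P <> setT &
      forall I J, two_sided_ideal I -> two_sided_ideal J ->
        (forall a b, I a -> J b -> P (a * b)) -> I `<=` P \/ J `<=` P].

Definition prime_chain (m : nat) (P : nat -> set A) : Prop :=
  (forall i, (i <= m)%N -> prime_ideal (P i)) /\
  (forall i, (i < m)%N -> P i `<` P i.+1).

Definition classical_Krull_dim : \bar R :=
  ereal_sup [set m%:R%:E | m in [set m : nat | exists P, prime_chain m P]].

End AlgebraDimensions.

(* Main.v *)
(** The free algebra acts on the polynomial ring [K[z, y, x]] by the formulas
    expressing left multiplication by a generator in the PBW basis; the action
    kills the relators, so [a |-> a . 1] is an inverse to the linear map sending
    a monomial to its PBW monomial.  This is the PBW theorem, and counting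
    monomials gives the Hilbert series and the growth.  In these coordinates,
    deglex leading monomials add up under multiplication.

    Powers of a generating subspace are squeezed between multiples of the degree
    filtration, so the Gelfand-Kirillov dimension is [3n].  For the classical
    Krull dimension, the ideals generated by the first [j] variables in the order
    [z, y, x] are completely prime and form a chain of length [3n].  Conversely,
    Dickson's lemma makes the algebra left and right noetherian; Goldie's
    argument then gives, for primes [P] strictly inside [Q], an element [c] of
    [Q] that is right-cancellable modulo [P].  If [w_i] are independent modulo
    [Q], the [w_i c^j] are independent modulo [P], so each step of a chain of
    primes lowers the growth exponent by one, and there are at most [3n] steps. *)

Require Import Defs.
From HB Require Import structures.
From mathcomp Require Import all_boot all_order all_algebra.
From mathcomp Require Import boolp classical_sets.
From mathcomp Require finmap monalg mpoly.
From mathcomp Require Import zify ring.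

Set Implicit Arguments.
Unset Strict Implicit.
Unset Printing Implicit Defensive.

Import Order.TTheory GRing.Theory Num.Theory.
Local Open Scope classical_set_scope.
Local Open Scope ring_scope.

(** * Dimension of subspaces *)

Section LinearAlgebra.
Variables (K : fieldType) (V : lmodType K).

(** Every relation is a [q]-commutation except [x_i y_i = q^-1 y_i x_i + z_i], where the extra [z_i]
    has degree 1 against 2. A degree-first order on exponents never sees this term, so at the level
    of leading monomials the algebra looks like a quantum polynomial ring, in particular like a
    domain. The [q]-integers [scoef b] appear only as coefficients and are never inverted, so roots
    of unity need no separate treatment. The same term dictates the order z, y, x of the chain of
    primes: an ideal containing [y_i] or [x_i] contains [z_i].

    In the upper bound for chains of primes no quotient algebra is formed: independence,
    annihilators and growth are all taken modulo a subset [P] of the algebra. Growth modulo [P] is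
    recorded as a bound [C * d.+1 ^ s] with a natural exponent [s], not as a limit superior, so that
    one strict inclusion of primes lowers [s] by one and [s = 0] leaves no room for a further
    prime. *)

Definition is_submod (U : set V) : Prop :=
  U 0 /\ forall k u v, U u -> U v -> U (k *: u + v).

(** For a subspace [P] this is independence of the classes in the quotient by [P]; [P = [set 0]]
    gives ordinary linear independence. *)
Definition indep_mod (P : set V) (k : nat) (b : 'I_k -> V) : Prop :=
  forall c : 'I_k -> K, P (\sum_i c i *: b i) -> forall i, c i = 0.

Lemma submod_sum (U : set V) (I : Type) (r : seq I) (p : pred I)
    (c : I -> K) (b : I -> V) :
  is_submod U -> (forall i, U (b i)) -> U (\sum_(i <- r | p i) c i *: b i).
Proof.
move=> [U0 UD] Ub; elim/big_ind: _ => [//|u v Uu Uv|i _].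
  by rewrite -[u]scale1r; apply: UD.
by rewrite -[_ *: _]addr0; apply: UD.
Qed.

Lemma lspan_submod (S : set V) : is_submod (lspan S).
Proof.
split; first by exists 0%N, (fun=> 0), (fun=> 0); split=> [[]//|]; rewrite big_ord0.
move=> k _ _ [m1 [c1 [s1 [S1 ->]]]] [m2 [c2 [s2 [S2 ->]]]].
pose glue (T : Type) (f : 'I_m1 -> T) (g : 'I_m2 -> T) (i : 'I_(m1 + m2)) :=
  match split i with inl j => f j | inr j => g j end.
exists (m1 + m2)%N, (glue _ (fun i => k * c1 i) c2), (glue _ s1 s2); split.
  by move=> i; rewrite /glue; case: (split i).
rewrite big_split_ord /= scaler_sumr.
congr (_ + _); apply: eq_bigr => i _; rewrite /glue.
  by rewrite (unsplitK (inl i)) scalerA.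
by rewrite (unsplitK (inr i)).
Qed.

Lemma sub_lspan (S : set V) : S `<=` lspan S.
Proof.
move=> v Sv; exists 1%N, (fun=> 1), (fun=> v); split=> //.
by rewrite big_ord1 scale1r.
Qed.

Lemma lspan_min (S U : set V) : is_submod U -> S `<=` U -> lspan S `<=` U.
Proof.
by move=> Um SU _ [m [c [s [Ss ->]]]]; apply: submod_sum => // i; apply: SU.
Qed.

Lemma lspan_rangeP (m : nat) (b : 'I_m -> V) (v : V) :
  lspan (range b) v <-> exists c : 'I_m -> K, v = \sum_i c i *: b i.
Proof.
split=> [|[c ->]]; last first.
  by apply: submod_sum => [|i]; [apply: lspan_submod|apply: sub_lspan; exists i].
apply: (lspan_min (U := [set v | exists c, v = \sum_i c i *: b i])).
  split=> [|k _ _ [c ->] [d ->]].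
    by exists (fun=> 0); rewrite big1 // => i _; rewrite scale0r.
  exists (fun i => k * c i + d i); rewrite scaler_sumr -big_split /=.
  by apply: eq_bigr => i _; rewrite scalerDl scalerA.
move=> _ [i _ <-]; exists (fun j => (j == i)%:R); rewrite (bigD1 i) //= eqxx scale1r big1 ?addr0 //.
by move=> j /negPf ->; rewrite scale0r.
Qed.

(** The matrix of coordinates of [b] along [v] has rank at most [m]; if [m < k], a nonzero row of
    its left kernel is a linear relation among the [b i]. *)
Lemma indep_span_le (m k : nat) (v : 'I_m -> V) (b : 'I_k -> V) :
  (forall i, lspan (range v) (b i)) -> indep_mod [set 0] b -> (k <= m)%N.
Proof.
move=> bv b_free.
have /choice[M bM] i : exists c : 'I_m -> K, b i = \sum_j c j *: v j.
  exact/lspan_rangeP/bv.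
pose A := \matrix_(i < k, j < m) M i j.
rewrite leqNgt; apply/negP => lt_mk.
have : kermx A != 0.
  by rewrite -mxrank_eq0 mxrank_ker subn_eq0 -ltnNge (leq_ltn_trans (rank_leq_col A)).
case/rowV0Pn => c /sub_kermxP cA /negP[]; apply/eqP/rowP => i.
rewrite mxE; apply: (b_free (fun i => c 0 i)).
transitivity (\sum_j (c *m A) 0 j *: v j); last first.
  by rewrite cA big1 // => j _; rewrite mxE scale0r.
under eq_bigr do rewrite bM scaler_sumr.
rewrite exchange_big /=; apply: eq_bigr => j _.
by rewrite mxE scaler_suml; apply: eq_bigr => l _; rewrite mxE scalerA.
Qed.

Lemma ldimE (U : set V) (m : nat) (b : 'I_m -> V) : is_basis U b -> ldim U = m.
Proof.
move=> bU; rewrite /ldim; case: xgetP => [k _ [b' b'U]|/(_ m)[]]; last by exists b.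
case: bU b'U => bU b_free [b'U b'_free]; apply/eqP; rewrite eqn_leq.
apply/andP; split.
  by apply: (indep_span_le (v := b) _ b'_free) => i; rewrite bU -b'U; apply: sub_lspan; exists i.
by apply: (indep_span_le (v := b') _ b_free) => i; rewrite b'U -bU; apply: sub_lspan; exists i.
Qed.

(** A free family in [U] of maximal length, which exists because lengths are bounded by [m], spans
    [U]: a vector outside its span could be added in front. *)
Lemma ex_basis (U : set V) (m : nat) (v : 'I_m -> V) :
  is_submod U -> U `<=` lspan (range v) ->
  exists k, (k <= m)%N /\ exists b : 'I_k -> V, is_basis U b.
Proof.
move=> Um Uv.
pose good k := `[< exists b : 'I_k -> V, (forall i, U (b i)) /\ indep_mod [set 0] b >].
have good_le k : good k -> (k <= m)%N.
  by move=> /asboolP[b [Ub]]; apply: indep_span_le => i; apply/Uv/Ub.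
have ex_good : exists k, good k by exists 0%N; apply/asboolP; exists (fun=> 0); split=> [[]|c _ []].
case: (ex_maxnP ex_good good_le) => k /[dup] /good_le le_km /asboolP[b [Ub b_free]] k_max.
exists k; split=> //; exists b; split=> //; rewrite eqEsubset; split.
  by apply: lspan_min => // _ [i _ <-].
move=> u Uu; apply: contrapT => bu.
suff /k_max : good k.+1 by rewrite ltnn.
pose b' (i : 'I_k.+1) := oapp b u (unlift ord0 i).
have b'S j : b' (lift ord0 j) = b j by rewrite /b' liftK.
have b'0 : b' ord0 = u by rewrite /b' unlift_none.
apply/asboolP; exists b'; split=> [i|c].
  by case: (unliftP ord0 i) => [j|] ->; rewrite ?b'S ?b'0.
rewrite /= big_ord_recl b'0; under eq_bigr do rewrite b'S.
move=> c0; have c00 : c ord0 = 0.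
  apply/eqP; apply: contrapT => /negP c_neq0; apply: bu.
  apply/lspan_rangeP; exists (fun i => - (c ord0)^-1 * c (lift ord0 i)).
  move/eqP: c0; rewrite addr_eq0 => /eqP c0.
  rewrite -[u](scale1r) -(mulVf c_neq0) -scalerA c0 -sumrN scaler_sumr.
  by apply: eq_bigr => i _; rewrite -scaleNr scalerA mulrN mulNr.
move: c0; rewrite c00 scale0r add0r => /b_free c0 i.
by case: (unliftP ord0 i) => [j|] ->.
Qed.

Lemma ldim_le (U : set V) (m : nat) (v : 'I_m -> V) :
  is_submod U -> U `<=` lspan (range v) -> (ldim U <= m)%N.
Proof. by move=> Um /(ex_basis Um)[k [le_km [b /ldimE ->]]]. Qed.

Lemma indep_ldim_le (U : set V) (m k : nat) (v : 'I_m -> V) (b : 'I_k -> V) :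
  is_submod U -> U `<=` lspan (range v) ->
  (forall i, U (b i)) -> indep_mod [set 0] b -> (k <= ldim U)%N.
Proof.
move=> Um /(ex_basis Um)[l [_ [b' b'U]]] Ub; rewrite (ldimE b'U).
by apply: (indep_span_le (v := b')) => i; case: b'U => ->.
Qed.

End LinearAlgebra.

Lemma linear_fun0 (K : fieldType) (V W : lmodType K) (f : V -> W) :
  linear f -> f 0 = 0.
Proof.
by move=> fL; apply: (addrI (f 0)); have := fL 1 0 0; rewrite !scale1r !addr0.
Qed.

Lemma linear_lincomb (K : fieldType) (V W : lmodType K) (f : V -> W) (J : Type)
    (r : seq J) (c : J -> K) (v : J -> V) : linear f ->
  f (\sum_(j <- r) c j *: v j) = \sum_(j <- r) c j *: f (v j).
Proof.
move=> fL; elim/big_rec2: _ => [|j a b _ <-]; last exact: fL.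
exact: linear_fun0.
Qed.

Section LinearClosure.
Variables (K : fieldType) (U V W : lmodType K).

Lemma linear_funcomp (f : V -> W) (g : U -> V) :
  linear f -> linear g -> linear (fun u => f (g u)).
Proof. by move=> fL gL k u v; rewrite gL fL. Qed.

Lemma linear_funscale c (f : U -> V) : linear f -> linear (fun u => c *: f u).
Proof. by move=> fL k u v; rewrite fL scalerDr !scalerA mulrC. Qed.

Lemma linear_funadd (f g : U -> V) :
  linear f -> linear g -> linear (fun u => f u + g u).
Proof. by move=> fL gL k u v; rewrite fL gL scalerDr addrACA. Qed.

End LinearClosure.

(** * Actions of free algebras *)

Section WordAction.
Import finmap monalg.
Variables (K : fieldType) (I : choiceType) (V : lmodType K) (step : I -> V -> V).
Hypothesis step_linear : forall g, linear (step g).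

Definition word_act (w : seq I) (v : V) : V := foldr step v w.

Definition free_act (u : {malg K[{fmonom I}]}) (v : V) : V :=
  \sum_(w <- msupp u) u@_w *: word_act w v.

Lemma word_act_linear w : linear (word_act w).
Proof.
elim: w => // g w IHw k u v.
by rewrite -[LHS]/(step g (word_act w _)) IHw step_linear.
Qed.

Lemma free_act_wider (d : {fset {fmonom I}}) u v : (msupp u `<=` d)%fset ->
  free_act u v = \sum_(w <- d) u@_w *: word_act w v.
Proof.
move=> le; rewrite /free_act (finmap.big_fset_incl _ le) //= => x _.
by move/mcoeff_outdom ->; rewrite scale0r.
Qed.

Lemma free_actDl k u1 u2 v :
  free_act (k *: u1 + u2) v = k *: free_act u1 v + free_act u2 v.
Proof.
pose d := (msupp u1 `|` msupp u2)%fset.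
have le1 : (msupp u1 `<=` d)%fset by apply: finmap.fsubsetUl.
have le2 : (msupp u2 `<=` d)%fset by apply: finmap.fsubsetUr.
have le3 : (msupp (k *: u1 + u2) `<=` d)%fset.
  apply: finmap.fsubset_trans (msuppD_le _ _) _.
  by rewrite finmap.fsubUset le2 (finmap.fsubset_trans (msuppZ_le _ _)).
rewrite (free_act_wider v le1) (free_act_wider v le2) (free_act_wider v le3).
rewrite scaler_sumr -big_split /=; apply: eq_bigr => w _.
by rewrite mcoeffD mcoeffZ scalerDl scalerA.
Qed.

Lemma free_act_linear u : linear (free_act u).
Proof.
move=> k v1 v2; rewrite /free_act scaler_sumr -big_split /=.
apply: eq_bigr => w _; rewrite word_act_linear scalerDr !scalerA.
by rewrite [u@_w * k]mulrC.
Qed.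

Lemma free_actU c w v : free_act << c *g w >> v = c *: word_act w v.
Proof. by rewrite (free_act_wider v msuppU_le) big_seq_fset1 mcoeffUU. Qed.

Lemma free_act_gen i v : free_act << fmu i >> v = step i v.
Proof. by rewrite free_actU scale1r /word_act fmuE. Qed.

Lemma free_act0 v : free_act 0 v = 0.
Proof. by rewrite /free_act msupp0 big_seq_fset0. Qed.

Lemma free_act_sum (J : Type) (r : seq J) (F : J -> {malg K[{fmonom I}]}) v :
  free_act (\sum_(j <- r) F j) v = \sum_(j <- r) free_act (F j) v.
Proof.
apply: (big_morph (free_act^~ v) _ (free_act0 v)) => u1 u2.
by rewrite -[u1]scale1r free_actDl !scale1r.
Qed.

Lemma free_act1 v : free_act 1 v = v.
Proof. by rewrite free_actU scale1r /word_act fm1. Qed.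

Lemma free_actM u1 u2 v : free_act (u1 * u2) v = free_act u1 (free_act u2 v).
Proof.
have act_w1 w1 : word_act w1 (free_act u2 v)
    = \sum_(w <- msupp u2) u2@_w *: word_act w1 (word_act w v).
  exact/linear_lincomb/word_act_linear.
rewrite malgME free_act_sum [RHS]/free_act; apply: eq_bigr => w1 _.
rewrite act_w1 free_act_sum scaler_sumr; apply: eq_bigr => w2 _.
rewrite free_actU scalerA; congr (_ *: _).
by rewrite /word_act -foldr_cat /mmul /= fmmulE.
Qed.
End WordAction.

Section FreeGenerators.
Import finmap monalg.
Variables (K : fieldType) (n : nat).

Definition free_gen (g : 'I_n + 'I_n + 'I_n) : free_alg K n :=
  match g with
  | inl (inl i) => freex K i
  | inl (inr i) => freey K i
  | inr i => freez K i
  end.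

Lemma free_genE g : free_gen g = << fmu g >>.
Proof. by case: g => [[]|]. Qed.

Section FreeAction.
Variables (V : lmodType K) (step : 'I_n + 'I_n + 'I_n -> V -> V).
Hypothesis step_linear : forall g, linear (step g).
Implicit Types (u v : free_alg K n) (p : V).
Local Notation act := (free_act step).

Lemma free_alg_actD u v p : act (u + v) p = act u p + act v p.
Proof. by have := free_actDl step 1 u v p; rewrite !scale1r. Qed.

Lemma free_alg_actZ k u p : act (k *: u) p = k *: act u p.
Proof. by have := free_actDl step k u 0 p; rewrite free_act0 !addr0. Qed.

Lemma free_alg_actB u v p : act (u - v) p = act u p - act v p.
Proof. by rewrite free_alg_actD; have := free_alg_actZ (-1) v p; rewrite !scaleN1r => ->. Qed.

Lemma free_alg_actM u v p : act (u * v) p = act u (act v p).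
Proof. exact: free_actM. Qed.

Lemma free_alg_act_gen g p : act (free_gen g) p = step g p.
Proof. by rewrite free_genE free_act_gen. Qed.

End FreeAction.

Section Intertwining.
Variables (q : K) (V : lmodType K) (step : 'I_n + 'I_n + 'I_n -> V -> V).
Variable f : V -> heis n q.
Hypothesis f_linear : linear f.
Hypothesis f_step : forall g v, f (step g v) = heis_proj q (free_gen g) * f v.

(** Serves with [f] the map from monomials to PBW monomials and [v] the constant 1: then [f (u . 1)]
    is the class of [u], so PBW monomials span. *)
Lemma free_act_intertwine (u : free_alg K n) v :
  f (free_act step u v) = heis_proj q u * f v.
Proof.
have f_word w : f (word_act step w v) = heis_proj q << FMonom w >> * f v.
  elim: w => [|g w IHw]; first by rewrite -fmoneE mul1r.
  rewrite -[LHS]/(f (step g (word_act step w v))) f_step IHw mulrA.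
  rewrite -[_ * heis_proj q _]heis_projM free_genE; congr (heis_proj q _ * _).
  rewrite malgME msuppU1 big_seq_fset1 msuppU1 big_seq_fset1 !mcoeffUU mulr1.
  by rewrite /mmul /= fmmulE fmuE.
rewrite [in RHS](monalgE u) /free_act (linear_lincomb _ _ _ f_linear).
rewrite (big_morph (heis_proj q) (@heis_projD _ _ q) (raddf0 _)) mulr_suml.
apply: eq_bigr => w _; rewrite f_word fmK scalerAl -[_ *: heis_proj q _]heis_projZ.
congr (heis_proj q _ * _).
by apply/malgP => w'; rewrite mcoeffZ [RHS]mcoeffU [X in _ * X]mcoeffU mulrnAr mulr1.
Qed.

End Intertwining.
End FreeGenerators.

Section MonomialBasis.
Import mpoly.
Variables (K : fieldType) (N : nat) (V : lmodType K).

Definition mlin (F : 'X_{1..N} -> V) (p : {mpoly K[N]}) : V :=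
  \sum_(m <- msupp p) p@_m *: F m.

Lemma mlin_wider (s : seq 'X_{1..N}) F p : uniq s -> {subset msupp p <= s} ->
  mlin F p = \sum_(m <- s) p@_m *: F m.
Proof.
move=> s_uniq le; rewrite [RHS](bigID (mem (msupp p))) /= [X in _ + X]big1 ?addr0.
  rewrite -big_filter; apply: perm_big; apply: uniq_perm.
  - exact: msupp_uniq.
  - exact: filter_uniq.
  - by move=> m; rewrite mem_filter /=; case: (boolP (m \in _)) => // /le ->.
by move=> m /memN_msupp_eq0 ->; rewrite scale0r.
Qed.

Lemma mlin_linear F : linear (mlin F).
Proof.
move=> k p1 p2; pose s := undup (msupp p1 ++ msupp p2).
rewrite !(@mlin_wider s) ?undup_uniq //; last first.
- move=> m /msuppD_le; rewrite !mem_cat mem_undup mem_cat.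
  by move=> /orP[/msuppZ_le ->|->]; rewrite ?orbT.
- by move=> m; rewrite mem_undup mem_cat => ->.
- by move=> m; rewrite mem_undup mem_cat orbC => ->.
rewrite scaler_sumr -big_split /=; apply: eq_bigr => m _.
by rewrite mcoeffD mcoeffZ scalerDl scalerA.
Qed.
HB.instance Definition _ F :=
  GRing.isLinear.Build K {mpoly K[N]} V *:%R (mlin F) (mlin_linear F).

Lemma mlinX F m : mlin F 'X_[m] = F m.
Proof. by rewrite /mlin msuppX big_seq1 mcoeffX eqxx scale1r. Qed.

Lemma mpoly_linear_ext (f g : {mpoly K[N]} -> V) : linear f -> linear g ->
  (forall m, f 'X_[m] = g 'X_[m]) -> f =1 g.
Proof.
move=> fL gL fg p; rewrite (mpolyE p).
rewrite (linear_lincomb _ _ _ fL) (linear_lincomb _ _ _ gL).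
by apply: eq_bigr => m _; rewrite fg.
Qed.

Lemma addmAC (m1 m2 m3 : 'X_{1..N}) : (m1 + m2 + m3 = m1 + m3 + m2)%MM.
Proof. by rewrite -!addmA [(m2 + m3)%MM]addmC. Qed.

(** Subtraction of exponents is truncated; the two operations commute because they touch different
    variables. *)
Lemma mnm_subUaddU (m : 'X_{1..N}) (a b : 'I_N) : a != b ->
  (m - U_(a) + U_(b) = m + U_(b) - U_(a))%MM.
Proof.
move=> ab; apply/mnmP => k; rewrite !mnmE.
case: (a =P k) => [ak|_]; last by rewrite !subn0.
by case: (b =P k) => [bk|_]; [rewrite ak bk eqxx in ab|rewrite !addn0].
Qed.

End MonomialBasis.

(** * The PBW basis *)

Section HeisenbergAction.
Import mpoly.
Variables (K : fieldType) (n : nat) (q : K).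
Hypothesis q_neq0 : q != 0.

Local Notation N := (n + n + n)%N.
Local Notation P := {mpoly K[N]}.
(* The order z, y, x of the variables is that of the factors of a PBW monomial. *)
Definition zvar (i : 'I_n) : 'I_N := lshift n (lshift n i).
Definition yvar (i : 'I_n) : 'I_N := lshift n (rshift n i).
Definition xvar (i : 'I_n) : 'I_N := rshift (n + n) i.

Lemma var_eqE : ((forall i j, (zvar i == zvar j) = (i == j)) *
  (forall i j, (yvar i == yvar j) = (i == j)) *
  (forall i j, (xvar i == xvar j) = (i == j)) *
  (forall i j, (zvar i == yvar j) = false) *
  (forall i j, (yvar i == zvar j) = false) *
  (forall i j, (zvar i == xvar j) = false) *
  (forall i j, (xvar i == zvar j) = false) *
  (forall i j, (xvar i == yvar j) = false) *
  (forall i j, (yvar i == xvar j) = false))%type.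
Proof.
by do !split=> *; rewrite /zvar /yvar /xvar
  ?(eq_lshift, eq_rshift, eq_lrshift, eq_rlshift).
Qed.

(* [x_i y_i^b = q^-b y_i^b x_i + scoef b z_i y_i^(b - 1)]. *)
Definition scoef (b : nat) : K := \sum_(k < b) (q ^- 2) ^+ k.

Lemma scoef0 : scoef 0 = 0.
Proof. by rewrite /scoef big_ord0. Qed.

Lemma scoefS b : scoef b.+1 = q ^- 2 * scoef b + 1.
Proof.
rewrite /scoef big_ord_recl expr0 addrC mulr_sumr; congr (_ + _).
by apply: eq_bigr => i _; rewrite -exprS.
Qed.

Definition zmon (i : 'I_n) (m : 'X_{1..N}) : P := 'X_[m + U_(zvar i)].
Definition ymon (i : 'I_n) (m : 'X_{1..N}) : P :=
  q ^- (m (zvar i)) *: 'X_[m + U_(yvar i)].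
(** The normal form of [x_i] times a PBW monomial: passing [z_i ^ a] costs [q ^ a], and passing
    [y_i ^ b] gives the two terms. For [b = 0] the truncated difference in the second monomial is
    meaningless, but [scoef 0 = 0] cancels it. *)
Definition xmon (i : 'I_n) (m : 'X_{1..N}) : P :=
  (q ^+ m (zvar i) * q ^- m (yvar i)) *: 'X_[m + U_(xvar i)] +
  (q ^+ m (zvar i) * scoef (m (yvar i))) *: 'X_[m + U_(zvar i) - U_(yvar i)].

Definition gen_step (g : 'I_n + 'I_n + 'I_n) : P -> P :=
  match g with
  | inl (inl i) => mlin (xmon i)
  | inl (inr i) => mlin (ymon i)
  | inr i => mlin (zmon i)
  end.

Lemma gen_step_linear g : linear (gen_step g).
Proof. by case: g => [[]|] i; apply: mlin_linear. Qed.

Local Notation zs i := (gen_step (inr i)).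
Local Notation ys i := (gen_step (inl (inr i))).
Local Notation xs i := (gen_step (inl (inl i))).

Ltac step_linear :=
  repeat first [exact: gen_step_linear | apply: linear_funscale
    | apply: linear_funadd | apply: linear_funcomp].

Lemma gen_step_zz i j p : zs i (zs j p) = zs j (zs i p).
Proof.
move: p; apply: mpoly_linear_ext => [||m]; try by step_linear.
by rewrite /= !mlinX /zmon addmAC.
Qed.

Let mvarE := (@mnmDE N, @mnmBE N, @mnm1E N, var_eqE, addn0, subn0).

Lemma gen_step_yz i j p :
  ys i (zs j p) = (if i == j then q^-1 else 1) *: zs j (ys i p).
Proof.
move: p; apply: mpoly_linear_ext => [||m]; try by step_linear.
rewrite /= !mlinX /ymon /zmon !linearZ /= !mlinX !mvarE addmAC scalerA [j == i]eq_sym.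
by case: eqP => _ /=; rewrite ?addn0 ?mulr1 ?mul1r // addn1 exprSr invfM.
Qed.

Lemma gen_step_yy i j p : ys i (ys j p) = ys j (ys i p).
Proof.
move: p; apply: mpoly_linear_ext => [||m]; try by step_linear.
rewrite /= !mlinX /ymon !linearZ /= !mlinX !mvarE addmAC !scalerA.
by rewrite mulrC.
Qed.

Lemma gen_step_xz i j p :
  xs i (zs j p) = (if i == j then q else 1) *: zs j (xs i p).
Proof.
move: p; apply: mpoly_linear_ext => [||m]; try by step_linear.
rewrite /= !mlinX linearD !linearZ /= !mlinX /xmon /zmon !mvarE.
rewrite mnm_subUaddU ?var_eqE // ![(m + U_(zvar j) + _)%MM]addmAC [j == i]eq_sym.
rewrite scalerDr !scalerA.
by case: eqP => _ /=; rewrite ?addn0 ?mulr1 ?mul1r // addn1 exprS !mulrA.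
Qed.

Lemma gen_step_xy_neq i j p : i != j -> xs i (ys j p) = ys j (xs i p).
Proof.
move=> ij; move: p; apply: mpoly_linear_ext => [||m]; try by step_linear.
rewrite /= !mlinX /xmon /ymon !(linearD, linearZ) /= !mlinX /xmon /ymon !mvarE.
rewrite mnm_subUaddU ?var_eqE // ![(m + U_(yvar j) + _)%MM]addmAC.
rewrite ![j == i]eq_sym (negPf ij) !addn0.
by rewrite scalerDr !scalerA ![_ * q ^- m (zvar j)]mulrC.
Qed.

Lemma gen_step_xy i p : xs i (ys i p) = q^-1 *: ys i (xs i p) + zs i p.
Proof.
move: p; apply: mpoly_linear_ext => [||m]; try by step_linear.
rewrite /= !mlinX /xmon /ymon /zmon !(linearD, linearZ) /= !mlinX /xmon /ymon !mvarE.
rewrite eqxx addn1 scoefS ![(m + U_(yvar i) + _)%MM]addmAC addmK.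
rewrite !scalerDr !scalerA -addrA; congr (_ *: _ + _).
  by rewrite exprS; field; rewrite q_neq0 !expf_neq0.
(* If [y_i] does not occur, subtracting and adding back its exponent is not the identity; the term
   then vanishes by [scoef 0 = 0], and the summand 1 of [scoefS] alone accounts for [z_i]. *)
case: (posnP (m (yvar i))) => [my0|m_gt0].
  by rewrite my0 scoef0 !(mulr0, mul0r) scale0r !add0r mulr1 mulVf ?scale1r ?expf_neq0.
rewrite submK; last first.
  by apply/mnm_lepP => k; rewrite !mvarE; case: eqP => // <-; rewrite (leq_trans m_gt0) ?leq_addr.
rewrite -[X in _ = _ + X]scale1r -scalerDl; congr (_ *: _).
by rewrite addn1 [q ^+ (m _).+1]exprS; field; rewrite q_neq0 !expf_neq0.
Qed.

Lemma gen_step_xx i j p : xs i (xs j p) = xs j (xs i p).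
Proof.
case: (eqVneq i j) => [->//|ij].
move: p; apply: mpoly_linear_ext => [||m]; try by step_linear.
rewrite /= !mlinX /xmon !(linearD, linearZ) /= !mlinX /xmon !mvarE.
rewrite ![j == i]eq_sym (negPf ij) !addn0 !subn0 !scalerDr !scalerA.
rewrite !(mnm_subUaddU, var_eqE) //.
have sAC (a b c d : 'X_{1..N}) : (m + a + b - c - d = m + b + a - d - c)%MM.
  by rewrite !submDA [(c + d)%MM]addmC addmAC.
rewrite [RHS]addrACA.
congr (_ *: 'X_[_] + _ *: 'X_[_] + (_ *: 'X_[_] + _ *: 'X_[_])).
1,3,5,7: by rewrite [LHS]mulrC.
- exact: addmAC.
- by congr (_ - _)%MM; exact: addmAC.
- by congr (_ - _)%MM; exact: addmAC.
- exact: sAC.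
Qed.

End HeisenbergAction.

Section CommutingProducts.
Variables (K : fieldType) (A : algType K) (I : eqType).
Implicit Types (g : I -> A) (r : seq I) (a : I -> nat).

(** The hypothesis concerns only the factors that really occur, so that [x_i] can be moved past a
    product of [y]'s without [y_i]. *)
Lemma prod_expr_skew (u : A) (c : I -> K) g r a :
  (forall i, a i != 0%N -> u * g i = c i *: (g i * u)) ->
  u * (\prod_(i <- r) g i ^+ a i)
    = (\prod_(i <- r) c i ^+ a i) *: ((\prod_(i <- r) g i ^+ a i) * u).
Proof.
move=> ug; elim: r => [|i r IHr]; first by rewrite !big_nil scale1r mulr1 mul1r.
rewrite !big_cons mulrA; have -> : u * g i ^+ a i = c i ^+ a i *: (g i ^+ a i * u).
  case: (eqVneq (a i) 0%N) => [->|/ug ugi]; first by rewrite !expr0 scale1r mulr1 mul1r.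
  elim: (a i) => [|k IHk]; first by rewrite !expr0 scale1r mulr1 mul1r.
  by rewrite !exprS mulrA ugi -scalerAl -[g i * u * _]mulrA IHk -scalerAr scalerA mulrA.
by rewrite -scalerAl -[_ * u * _]mulrA IHr -scalerAr scalerA mulrA.
Qed.

Lemma prod_expr_incr g r a j :
  (forall i k, GRing.comm (g i) (g k)) -> j \in r -> uniq r ->
  g j * (\prod_(i <- r) g i ^+ a i) = \prod_(i <- r) g i ^+ (a i + (j == i))%N.
Proof.
move=> gC; elim: r => // i r IHr; rewrite inE !big_cons /=.
case: (eqVneq j i) => [<- _ /andP[jr _]|_ /= jr /andP[_ r_uniq]].
  rewrite addn1 exprS mulrA; congr (_ * _); apply: eq_big_seq => k kr.
  by case: eqP kr jr => [->->//|_ _ _]; rewrite addn0.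
by rewrite addn0 -IHr // !mulrA; congr (_ * _); apply: commrX.
Qed.

End CommutingProducts.

Section HeisenbergPBW.
Import mpoly.
Variables (K : fieldType) (n : nat) (q : K).
Hypothesis q_neq0 : q != 0.

Local Notation N := (n + n + n)%N.
Local Notation P := {mpoly K[N]}.
Local Notation H := (heis n q).
Local Notation zs i := (gen_step q (inr i)).
Local Notation ys i := (gen_step q (inl (inr i))).
Local Notation xs i := (gen_step q (inl (inl i))).

Definition heis_gen (g : 'I_n + 'I_n + 'I_n) : H := heis_proj q (free_gen K g).

Lemma heis_relators_act0 (A : lalgType K) (x y z : 'I_n -> A) (act : A -> P -> P) :
    (forall u v p, act (u * v) p = act u (act v p)) ->
    (forall u v p, act (u - v) p = act u p - act v p) ->
    (forall u v p, act (u + v) p = act u p + act v p) ->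
    (forall k u p, act (k *: u) p = k *: act u p) ->
    (forall i p, act (x i) p = xs i p) -> (forall i p, act (y i) p = ys i p) ->
    (forall i p, act (z i) p = zs i p) ->
  forall r p, heis_relators q x y z r -> act r p = 0.
Proof.
move=> actM actB actD actZ actx acty actz r p.
case=> [[[i [j [_]]]|[i]]|[i [j [ij]]]] [] ->; rewrite actB ?actD ?actZ !actM;
  rewrite !(actx, acty, actz).
- by rewrite gen_step_xx subrr.
- by rewrite gen_step_yy subrr.
- by rewrite gen_step_zz subrr.
- by rewrite gen_step_xz eqxx subrr.
- by rewrite gen_step_yz eqxx subrr.
- by rewrite gen_step_xy // subrr.
- by rewrite gen_step_xy_neq // subrr.
- by rewrite gen_step_xz (negPf ij) scale1r subrr.
- by rewrite gen_step_yz (negPf ij) scale1r subrr.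
Qed.

Definition heis_act (u : free_alg K n) (p : P) : P := free_act (gen_step q) u p.

Lemma heis_actM u v p : heis_act (u * v) p = heis_act u (heis_act v p).
Proof. exact: (free_alg_actM (gen_step_linear q)). Qed.

Lemma heis_actD u v p : heis_act (u + v) p = heis_act u p + heis_act v p.
Proof. exact: free_alg_actD. Qed.

Lemma heis_actB u v p : heis_act (u - v) p = heis_act u p - heis_act v p.
Proof. exact: free_alg_actB. Qed.

Lemma heis_actZ k u p : heis_act (k *: u) p = k *: heis_act u p.
Proof. exact: free_alg_actZ. Qed.

Lemma heis_act_gen g p : heis_act (free_gen K g) p = gen_step q g p.
Proof. exact: free_alg_act_gen. Qed.

Lemma heis_act_linear u : linear (heis_act u).
Proof. exact: (free_act_linear (gen_step_linear q)). Qed.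

Lemma heis_act1 p : heis_act 1 p = p.
Proof. exact: free_act1. Qed.

Lemma heis_act_ideal u p : u \in @heis_ideal K n q -> heis_act u p = 0.
Proof.
case/ideal_predP=> m [a [s [b [Ss ->]]]].
have act0 v : heis_act v 0 = 0 by apply: linear_fun0 (heis_act_linear v).
rewrite (big_morph (heis_act^~ p) (fun u v => heis_actD u v p) (id1 := 0)); last first.
  by have := heis_actB 0 0 p; rewrite !subrr.
rewrite big1 // => i _.
rewrite heis_actM [heis_act (a i * s i) _]heis_actM.
rewrite (heis_relators_act0 heis_actM heis_actB heis_actD heis_actZ _ _ _ _ (Ss i)).
- exact: act0.
- by move=> k p'; apply: (heis_act_gen (inl (inl k))).
- by move=> k p'; apply: (heis_act_gen (inl (inr k))).
- by move=> k p'; apply: (heis_act_gen (inr k)).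
Qed.

End HeisenbergPBW.

Section HeisenbergCoordinates.
Import mpoly.
Variables (K : fieldType) (n : nat) (q : K).
Hypothesis q_neq0 : q != 0.

Local Notation N := (n + n + n)%N.
Local Notation P := {mpoly K[N]}.
Local Notation H := (heis n q).

Definition heis_coord (a : H) : P := heis_act q (repr a) 'X_[0].

(** Independence of the representative: the defining ideal acts by zero. *)
Lemma heis_coord_proj u : heis_coord (heis_proj q u) = heis_act q u 'X_[0].
Proof.
apply/eqP; rewrite -subr_eq0; apply/eqP.
by rewrite -heis_actB (heis_act_ideal q_neq0) ?repr_heis_proj.
Qed.

Lemma heis_coord_linear : linear heis_coord.
Proof.
move=> k a b; rewrite -(heis_projK a) -(heis_projK b).
have -> : k *: heis_proj q (repr a) + heis_proj q (repr b) =
  heis_proj q (k *: repr a + repr b) by rewrite heis_projD heis_projZ.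
by rewrite !heis_coord_proj heis_actD heis_actZ.
Qed.

Lemma heis_coord_gen g a :
  heis_coord (heis_gen q g * a) = gen_step q g (heis_coord a).
Proof.
rewrite -(heis_projK a) -[_ * _]heis_projM !heis_coord_proj.
by rewrite heis_actM heis_act_gen.
Qed.

Lemma heis_coord1 : heis_coord 1 = 1.
Proof. by rewrite [LHS]heis_coord_proj heis_act1 mpolyX0. Qed.

Definition pbw (m : 'X_{1..N}) : H :=
  pbw_monomial q (fun i => m (zvar i)) (fun i => m (yvar i)) (fun i => m (xvar i)).

Definition gen_var (g : 'I_n + 'I_n + 'I_n) : 'I_N :=
  match g with
  | inl (inl i) => xvar i
  | inl (inr i) => yvar i
  | inr i => zvar i
  end.

Lemma heis_coord_expr g k a m :
  (forall j, gen_step q g 'X_[m + U_(gen_var g) *+ j] = 'X_[m + U_(gen_var g) *+ j.+1]) ->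
  heis_coord a = 'X_[m] ->
  heis_coord (heis_gen q g ^+ k * a) = 'X_[m + U_(gen_var g) *+ k].
Proof.
move=> gm am; elim: k => [|k IHk]; first by rewrite mul1r am mulm0n addm0.
by rewrite exprS -mulrA heis_coord_gen IHk gm.
Qed.

(** [C] is a stable set of monomials on which every [g i] acts by raising one exponent, with
    coefficient 1. Building a PBW monomial from the right never leaves such a set. *)
Lemma heis_coord_prod (g : 'I_n -> 'I_n + 'I_n + 'I_n) (C : {pred 'X_{1..N}})
    (e : 'I_n -> nat) (r : seq 'I_n) a m :
  (forall i m', m' \in C -> (m' + U_(gen_var (g i)))%MM \in C) ->
  (forall i m', m' \in C -> gen_step q (g i) 'X_[m'] = 'X_[m' + U_(gen_var (g i))]) ->
  m \in C -> heis_coord a = 'X_[m] ->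
  heis_coord ((\prod_(i <- r) heis_gen q (g i) ^+ e i) * a)
    = 'X_[m + \sum_(i <- r) U_(gen_var (g i)) *+ e i].
Proof.
move=> CU gC Cm am.
suff : heis_coord ((\prod_(i <- r) heis_gen q (g i) ^+ e i) * a)
    = 'X_[m + \sum_(i <- r) U_(gen_var (g i)) *+ e i] /\
  (m + \sum_(i <- r) U_(gen_var (g i)) *+ e i)%MM \in C by case.
have CUn i m' j : m' \in C -> (m' + U_(gen_var (g i)) *+ j)%MM \in C.
  move=> Cm'; elim: j => [|j IHj]; first by rewrite mulm0n addm0.
  by rewrite mulmSr addmA; apply: CU.
elim: r => [|i r [IHr Cr]]; first by rewrite !big_nil mul1r addm0.
rewrite !big_cons -mulrA [(U_(_) *+ _ + _)%MM]addmC addmA; split; last exact: CUn.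
apply: heis_coord_expr => // j.
by rewrite gC; [rewrite mulmSr addmA|apply: CUn].
Qed.

Lemma heis_coord_pbw m : heis_coord (pbw m) = 'X_[m].
Proof.
(* The [x_i] act without correction on monomials in the x's only, the [y_i] on monomials free of
   z's, and the [z_i] everywhere, whence [predT] below. *)
pose Cx : {pred 'X_{1..N}} :=
  [pred m : 'X_{1..N} | [forall i : 'I_n, (m (zvar i) == 0%N) && (m (yvar i) == 0%N)]].
pose Cy : {pred 'X_{1..N}} := [pred m : 'X_{1..N} | [forall i : 'I_n, m (zvar i) == 0%N]].
have CxP m' : m' \in Cx -> forall i, m' (zvar i) = 0%N /\ m' (yvar i) = 0%N.
  by move/forallP => Cm i; have /andP[/eqP-> /eqP->] := Cm i.
have CyP m' : m' \in Cy -> forall i, m' (zvar i) = 0%N.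
  by move/forallP => Cm i; apply/eqP.
rewrite /pbw /pbw_monomial -mulrA.
have mE : m = (0 + \sum_i U_(xvar i) *+ m (xvar i) + \sum_i U_(yvar i) *+ m (yvar i)
    + \sum_i U_(zvar i) *+ m (zvar i))%MM :> 'X_{1..N}.
  by rewrite add0m [LHS]multinomUE_id !big_split_ord /= [RHS]addmC addmA addmAC.
rewrite [X in _ = 'X_[X]]mE {mE}.
apply: (@heis_coord_prod (fun i => inr i) predT (fun i => m (zvar i))) => //.
  by move=> i m' _; rewrite /= mlinX.
apply: (@heis_coord_prod (fun i => inl (inr i)) Cy (fun i => m (yvar i))).
- move=> i m' /CyP Cm'; apply/forallP => j.
  by rewrite mnmDE Cm' mnm1E var_eqE.
- by move=> i m' /CyP Cm'; rewrite /= mlinX /ymon Cm' invr1 scale1r.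
- apply/forallP => j; rewrite mnmDE mnm0E mnm_sumE big1 // => i _.
  by rewrite mulmnE mnm1E var_eqE.
rewrite -[X in heis_coord X]mulr1.
apply: (@heis_coord_prod (fun i => inl (inl i)) Cx (fun i => m (xvar i))).
- move=> i m' /CxP Cm'; apply/forallP => j.
  by rewrite !mnmDE !mnm1E !var_eqE; have [-> ->] := Cm' j.
- move=> i m' /CxP /(_ i)[mz my]; rewrite /= mlinX /xmon mz my scoef0.
  by rewrite mulr0 scale0r addr0 invr1 mulr1 scale1r.
- by apply/forallP => j; rewrite !mnm0E.
by rewrite heis_coord1 mpolyX0.
Qed.

End HeisenbergCoordinates.

(** * Left multiplication by a generator, computed from the relations alone *)

Section SkewRelations.
Import mpoly.
Variables (K : fieldType) (n : nat) (q : K) (A : algType K) (x y z : 'I_n -> A).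
Hypotheses (xx : forall i j, GRing.comm (x i) (x j))
  (yy : forall i j, GRing.comm (y i) (y j)) (zz : forall i j, GRing.comm (z i) (z j))
  (xz : forall i j, x i * z j = (if i == j then q else 1) *: (z j * x i))
  (yz : forall i j, y i * z j = (if i == j then q^-1 else 1) *: (z j * y i))
  (xy : forall i, x i * y i = q^-1 *: (y i * x i) + z i)
  (xy_neq : forall i j, i != j -> x i * y j = y j * x i).

Local Notation N := (n + n + n)%N.

Definition zprod (a : 'I_n -> nat) : A := \prod_i z i ^+ a i.
Definition yprod (a : 'I_n -> nat) : A := \prod_i y i ^+ a i.
Definition xprod (a : 'I_n -> nat) : A := \prod_i x i ^+ a i.

Lemma zprod_incr i a : z i * zprod a = zprod (fun k => a k + (i == k))%N.
Proof. by rewrite /zprod (prod_expr_incr (g := z)) ?mem_index_enum ?index_enum_uniq //; apply: zz. Qed.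

Lemma yprod_incr i a : y i * yprod a = yprod (fun k => a k + (i == k))%N.
Proof. by rewrite /yprod (prod_expr_incr (g := y)) ?mem_index_enum ?index_enum_uniq //; apply: yy. Qed.

Lemma xprod_incr i a : x i * xprod a = xprod (fun k => a k + (i == k))%N.
Proof. by rewrite /xprod (prod_expr_incr (g := x)) ?mem_index_enum ?index_enum_uniq //; apply: xx. Qed.

Lemma prod_delta_expr (i : 'I_n) (c : K) (a : 'I_n -> nat) :
  \prod_k (if i == k then c else 1) ^+ a k = c ^+ a i.
Proof.
rewrite (bigD1 i) //= eqxx big1 ?mulr1 // => k.
by rewrite eq_sym => /negPf ->; rewrite expr1n.
Qed.

Lemma x_zprod i a : x i * zprod a = q ^+ a i *: (zprod a * x i).
Proof.
rewrite /zprod (prod_expr_skew (c := fun k => if i == k then q else 1)).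
  by rewrite prod_delta_expr.
by move=> k _; apply: xz.
Qed.

Lemma y_zprod i a : y i * zprod a = q ^- a i *: (zprod a * y i).
Proof.
rewrite /zprod (prod_expr_skew (c := fun k => if i == k then q^-1 else 1)).
  by rewrite prod_delta_expr exprVn.
by move=> k _; apply: yz.
Qed.

Lemma z_zprod i a : zprod a * z i = z i * zprod a.
Proof.
rewrite [RHS](prod_expr_skew (c := fun=> 1)) => [|k _].
  by rewrite big1 ?scale1r // => k _; rewrite expr1n.
by rewrite scale1r; apply: zz.
Qed.

Lemma eq_yprod a b : a =1 b -> yprod a = yprod b.
Proof. by move=> ab; apply: eq_bigr => k _; rewrite ab. Qed.

(** Induction on [b i], taking one [y_i] out on the left. The [z_i] of the induction hypothesis
    stands to the right of [y_i]; together with the [q^-1] from exchanging [x_i] and [y_i], moving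
    it back gives the ratio [q ^- 2] of [scoef]. *)
Lemma x_yprod i b : x i * yprod b = q ^- b i *: (yprod b * x i)
  + scoef q (b i) *: (z i * yprod (fun k => b k - (i == k))%N).
Proof.
have [k] := ubnP (b i); elim: k b => // k IHk b; rewrite ltnS => le_bk.
case: (posnP (b i)) => [bi0|bi_gt0].
  rewrite bi0 scoef0 scale0r addr0 invr1 scale1r.
  rewrite [LHS](prod_expr_skew (c := fun=> 1)) => [|l bl].
    by rewrite big1 ?scale1r // => l _; rewrite expr1n.
  by rewrite scale1r xy_neq //; apply: contra_neq bl => <-.
pose b' l := (b l - (i == l))%N; rewrite -/b'.
have yb' : yprod b = y i * yprod b'.
  rewrite yprod_incr; apply: eq_yprod => l; rewrite /b' subnK //.
  by case: eqP => // <-.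
have b'i : b i = (b' i).+1 by rewrite /b' eqxx subn1 prednK.
have lt_b'k : (b' i < k)%N by rewrite -b'i.
rewrite b'i scoefS yb' mulrA xy mulrDl -scalerAl -[y i * x i * _]mulrA.
rewrite (IHk _ lt_b'k) mulrDr -!scalerAr [y i * (z i * _)]mulrA yz eqxx.
set b'' := fun l => (b' l - (i == l))%N.
rewrite -scalerAl -[z i * y i * _]mulrA.
(* For [b' i = 0] the truncation in [b''] prevents [y_i] from restoring [yprod b'], but both sides
   then vanish since [scoef 0 = 0]. *)
have -> : scoef q (b' i) *: (q^-1 *: (z i * (y i * yprod b'')))
    = scoef q (b' i) *: (q^-1 *: (z i * yprod b')).
  case: (posnP (b' i)) => [->|b'i_gt0]; first by rewrite scoef0 !scale0r.
  congr (_ *: (_ *: (_ * _))); rewrite yprod_incr; apply: eq_yprod => l.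
  by rewrite /b'' subnK //; case: eqP => // <-.
rewrite scalerDr !scalerA -addrA; congr (_ *: _ + _).
- by rewrite exprS invfM.
- by rewrite mulrA.
rewrite scalerDl scale1r; congr (_ *: _ + _).
by rewrite expr2 invfM mulrAC.
Qed.

Definition pbw_of (m : 'X_{1..N}) : A :=
  zprod (fun i => m (zvar i)) * yprod (fun i => m (yvar i))
  * xprod (fun i => m (xvar i)).

Let mvarE := (@mnmDE N, @mnmBE N, @mnm1E N, @var_eqE n).

Lemma pbw_monomialE (a b c : 'I_n -> nat) (m : 'X_{1..N}) :
  (forall i, m (zvar i) = a i) -> (forall i, m (yvar i) = b i) ->
  (forall i, m (xvar i) = c i) -> zprod a * yprod b * xprod c = pbw_of m.
Proof.
by move=> ma mb mc; congr (_ * _ * _); apply: eq_bigr => i _; rewrite ?ma ?mb ?mc.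
Qed.

Definition gen_of (g : 'I_n + 'I_n + 'I_n) : A :=
  match g with
  | inl (inl i) => x i
  | inl (inr i) => y i
  | inr i => z i
  end.

(** The formulas defining the action are the true multiplication rules in any algebra satisfying the
    relations. *)
Lemma mlin_pbw_step g p :
  mlin pbw_of (gen_step q g p) = gen_of g * mlin pbw_of p.
Proof.
move: p; apply: mpoly_linear_ext => [||m].
- by apply: linear_funcomp; [apply: mlin_linear|apply: gen_step_linear].
- move=> k u v; rewrite mlin_linear mulrDr; congr (_ + _).
  by rewrite scalerAr.
rewrite [in RHS]mlinX [in RHS]/pbw_of.
case: g => [[]|] i; rewrite /gen_step mlinX.
- rewrite -[gen_of _]/(x i) !mulrA x_zprod -!scalerAl -[zprod _ * x i * _]mulrA.
  rewrite x_yprod mulrDr mulrDl -!scalerAr -!scalerAl scalerDr !scalerA.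
  rewrite /xmon [mlin _ (_ + _)]linearD /= ![mlin _ (_ *: _)]linearZ /= !mlinX.
  congr (_ *: _ + _ *: _).
    rewrite [zprod _ * (_ * x i)]mulrA -[_ * x i * _]mulrA xprod_incr; apply/esym.
    by apply: pbw_monomialE => k; rewrite !mvarE ?addn0.
  rewrite [zprod _ * (z i * _)]mulrA z_zprod zprod_incr; apply/esym.
  by apply: pbw_monomialE => k; rewrite !mvarE ?addn0 ?subn0.
- rewrite -[gen_of _]/(y i) !mulrA y_zprod -!scalerAl -[zprod _ * y i * _]mulrA.
  rewrite /ymon [mlin _ _]linearZ /= mlinX yprod_incr; congr (_ *: _); apply/esym.
  by apply: pbw_monomialE => k; rewrite !mvarE ?addn0.
rewrite -[gen_of _]/(z i) !mulrA /zmon mlinX zprod_incr; apply/esym.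
by apply: pbw_monomialE => k; rewrite !mvarE ?addn0.
Qed.

Lemma pbw_of0 : pbw_of 0%MM = 1.
Proof.
by rewrite /pbw_of /zprod /yprod /xprod !big1 ?mul1r // => i _; rewrite mnm0E.
Qed.

End SkewRelations.

Section HeisenbergSpanning.
Import mpoly.
Variables (K : fieldType) (n : nat) (q : K).
Hypothesis q_neq0 : q != 0.

Local Notation N := (n + n + n)%N.
Local Notation P := {mpoly K[N]}.
Local Notation H := (heis n q).
Local Notation x := (@heisx K n q).
Local Notation y := (@heisy K n q).
Local Notation z := (@heisz K n q).

Lemma heis_proj_relator (u v : free_alg K n) :
  heis_relators q (@freex K n) (@freey K n) (@freez K n) (u - v) ->
  heis_proj q u = heis_proj q v.
Proof.
move=> uv; apply/heis_proj_eqP/ideal_predP.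
by exists 1%N, (fun=> 1), (fun=> u - v), (fun=> 1); rewrite big_ord1 mul1r mulr1.
Qed.

Lemma heis_comm_lt (g : 'I_n -> free_alg K n) :
  (forall i j : 'I_n, (i < j)%N ->
    heis_relators q (@freex K n) (@freey K n) (@freez K n) (g i * g j - g j * g i)) ->
  forall i j, GRing.comm (heis_proj q (g i)) (heis_proj q (g j)).
Proof.
move=> gR.
have gC (i j : 'I_n) : (i < j)%N -> GRing.comm (heis_proj q (g i)) (heis_proj q (g j)).
  move=> /gR/heis_proj_relator gE.
  by rewrite /GRing.comm -[LHS]heis_projM -[RHS]heis_projM.
move=> i j; case: (ltngtP i j) => [/gC//|/gC/commr_sym//|/val_inj ->].
exact: commr_refl.
Qed.

Lemma heis_xx i j : GRing.comm (x i) (x j).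
Proof.
by apply: (heis_comm_lt (g := @freex K n)) => {}i {}j ij; left; left; exists i, j; split=> //; constructor 1.
Qed.

Lemma heis_yy i j : GRing.comm (y i) (y j).
Proof.
by apply: (heis_comm_lt (g := @freey K n)) => {}i {}j ij; left; left; exists i, j; split=> //; constructor 2.
Qed.

Lemma heis_zz i j : GRing.comm (z i) (z j).
Proof.
by apply: (heis_comm_lt (g := @freez K n)) => {}i {}j ij; left; left; exists i, j; split=> //; constructor 3.
Qed.

Lemma heis_xz i j : x i * z j = (if i == j then q else 1) *: (z j * x i).
Proof.
rewrite -[x i * _]heis_projM -[z j * _]heis_projM -[_ *: _]heis_projZ.
apply: heis_proj_relator; case: eqP => [->|/eqP ij].
  by left; right; exists j; constructor 1.
by right; exists i, j; split=> //; constructor 2; rewrite scale1r.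
Qed.

Lemma heis_yz i j : y i * z j = (if i == j then q^-1 else 1) *: (z j * y i).
Proof.
rewrite -[y i * _]heis_projM -[z j * _]heis_projM -[_ *: _]heis_projZ.
apply: heis_proj_relator; case: eqP => [->|/eqP ij].
  by left; right; exists j; constructor 2.
by right; exists i, j; split=> //; constructor 3; rewrite scale1r.
Qed.

Lemma heis_xy i : x i * y i = q^-1 *: (y i * x i) + z i.
Proof.
rewrite -[x i * _]heis_projM -[y i * _]heis_projM -[_ *: _]heis_projZ.
rewrite -[_ + _]heis_projD; apply: heis_proj_relator.
by left; right; exists i; constructor 3.
Qed.

Lemma heis_xy_neq i j : i != j -> x i * y j = y j * x i.
Proof.
move=> ij; rewrite -[x i * _]heis_projM -[y j * _]heis_projM.
by apply: heis_proj_relator; right; exists i, j; split=> //; constructor 1.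
Qed.

Definition heis_of_coord : P -> H := mlin (pbw q).

Lemma heis_of_coord_step g p :
  heis_of_coord (gen_step q g p) = heis_gen q g * heis_of_coord p.
Proof.
have := mlin_pbw_step heis_xx heis_yy heis_zz heis_xz heis_yz heis_xy heis_xy_neq g p.
by case: g => [[]|].
Qed.

Lemma heis_coordK : cancel (heis_coord (q := q)) heis_of_coord.
Proof.
move=> a; rewrite -[RHS]heis_projK -[RHS]mulr1 -(pbw_of0 x y z) -[pbw_of x y z 0%MM](mlinX (pbw q)).
apply: free_act_intertwine; first exact: mlin_linear.
exact: heis_of_coord_step.
Qed.

Lemma heis_of_coordK : cancel heis_of_coord (heis_coord (q := q)).
Proof.
apply: mpoly_linear_ext => [||m].
- apply: linear_funcomp; [exact: heis_coord_linear|exact: mlin_linear].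
- by [].
by rewrite /heis_of_coord mlinX heis_coord_pbw.
Qed.

End HeisenbergSpanning.

(** * Leading monomials *)

Section LeadingMonomial.
Import mpoly.
Variables (K : fieldType) (N : nat).
Local Notation P := {mpoly K[N]}.

Definition lead_at (p : P) (m : 'X_{1..N}) : Prop :=
  p@_m != 0 /\ forall k, (m < k)%O -> p@_k = 0.

Lemma lead_atP p m : lead_at p m <-> p != 0 /\ mlead p = m.
Proof.
split=> [[pm pk]|[p0 <-]]; last first.
  by split=> [|k]; [rewrite mleadc_eq0|apply: mcoeff_gt_mlead].
have p_neq0 : p != 0 by apply: contra_neq pm => ->; rewrite mcoeff0.
split=> //; apply/le_anti/andP; split.
  rewrite leNgt; apply/negP => /pk/eqP.
  by rewrite mleadc_eq0 (negPf p_neq0).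
by apply: msupp_le_mlead; rewrite mcoeff_msupp.
Qed.

(** The order is compatible with addition, so the other terms of [p] contribute only below
    [mlead p + u] and cannot cancel the top one. *)
Lemma lead_at_mlin (F : 'X_{1..N} -> P) (u : 'X_{1..N}) (p : P) :
  (forall m, lead_at (F m) (m + u)%MM) -> p != 0 ->
  lead_at (mlin F p) (mlead p + u)%MM.
Proof.
move=> Fl p_neq0; rewrite /mlin.
have Fgt m k : ((mlead p + u)%MM < k)%O -> m \in msupp p -> (F m)@_k = 0.
  move=> lt_k /msupp_le_mlead le_m; case: (Fl m) => _; apply.
  by apply: le_lt_trans lt_k; rewrite lemc_add2l.
split=> [|k lt_k]; last first.
  rewrite raddf_sum /= big_seq big1 // => m mp.
  by rewrite mcoeffZ Fgt ?mulr0.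
rewrite raddf_sum /= (bigD1_seq (mlead p)) ?msupp_uniq ?mlead_supp //=.
rewrite mcoeffZ big_seq_cond big1 ?addr0 => [|m /andP[mp m_neq]].
  by rewrite mulf_neq0 ?mleadc_eq0 //; case: (Fl (mlead p)).
rewrite mcoeffZ; have [_ ->] := Fl m; first by rewrite mulr0.
by rewrite ltmc_add2l lt_neqAle m_neq msupp_le_mlead.
Qed.

Lemma lead_at_X c (m : 'X_{1..N}) : c != 0 -> lead_at (c *: 'X_[m] : P) m.
Proof.
move=> c_neq0; split; first by rewrite mcoeffZ mcoeffX eqxx mulr1.
by move=> k /lt_eqF mk; rewrite mcoeffZ mcoeffX mk mulr0.
Qed.

End LeadingMonomial.

Section HeisenbergLead.
Import mpoly.
Variables (K : fieldType) (n : nat) (q : K).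
Hypothesis q_neq0 : q != 0.

Local Notation N := (n + n + n)%N.
Local Notation P := {mpoly K[N]}.
Local Notation H := (heis n q).

(** The second term of [xmon] trades [x_i] and [y_i] for [z_i], so its degree is one lower and a
    degree-first order places it below; the first coefficient is a unit. *)
Lemma lead_at_xmon i (m : 'X_{1..N}) : lead_at (xmon q i m) (m + U_(xvar i))%MM.
Proof.
rewrite /xmon; set c := (_ * q ^- _).
have c_neq0 : c != 0 by rewrite mulf_neq0 ?invr_neq0 ?expf_neq0.
case: (posnP (m (yvar i))) => [->|m_gt0].
  by rewrite scoef0 mulr0 scale0r addr0; apply: lead_at_X.
set k := (m + U_(zvar i) - _)%MM.
have lt_k : (k < (m + U_(xvar i))%MM)%O.
  apply: lt_mdeg_ltmc; have kE : (k + U_(yvar i) = m + U_(zvar i))%MM.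
    rewrite submK //; apply/mnm_lepP => j; rewrite mnmDE !mnm1E.
    by case: eqP => // <-; rewrite (leq_trans m_gt0) ?leq_addr.
  have := congr1 (@mdeg _) kE; rewrite !mdegD !mdeg1 !addn1 => -[->].
  exact: ltnSn.
split=> [|l lt_l]; rewrite mcoeffD !mcoeffZ !mcoeffX.
  by rewrite eqxx (lt_eqF lt_k) mulr0 addr0 mulr1.
by rewrite (lt_eqF lt_l) (lt_eqF (lt_trans lt_k lt_l)) !mulr0 addr0.
Qed.

Lemma lead_at_step g (p : P) m :
  lead_at p m -> lead_at (gen_step q g p) (U_(gen_var g) + m)%MM.
Proof.
case/lead_atP => p_neq0 <-; rewrite addmC.
case: g => [[]|] i; apply: lead_at_mlin => // {}m.
- exact: lead_at_xmon.
- by apply: lead_at_X; rewrite invr_neq0 ?expf_neq0.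
- by rewrite /zmon -[X in lead_at X]scale1r; apply: lead_at_X; rewrite oner_neq0.
Qed.

Local Notation phi := (@heis_coord K n q).

(** Quantifying over all [b] makes the property stable under products, so it passes from generators
    to PBW monomials before additivity of leading monomials is known. *)
Definition lead_mul (a : H) (u : 'X_{1..N}) : Prop :=
  forall b m, lead_at (phi b) m -> lead_at (phi (a * b)) (u + m)%MM.

Lemma lead_mul1 : lead_mul 1 0%MM.
Proof. by move=> b m; rewrite mul1r add0m. Qed.

Lemma lead_mulM a u b v : lead_mul a u -> lead_mul b v -> lead_mul (a * b) (u + v)%MM.
Proof. by move=> au bv c m cm; rewrite -mulrA -addmA; apply/au/bv. Qed.

Lemma lead_mul_gen g : lead_mul (heis_gen q g) U_(gen_var g)%MM.
Proof. by move=> b m bm; rewrite (heis_coord_gen q_neq0); apply: lead_at_step. Qed.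

Lemma lead_mul_prod (g : 'I_n -> 'I_n + 'I_n + 'I_n) (e : 'I_n -> nat) :
  lead_mul (\prod_i heis_gen q (g i) ^+ e i) (\sum_i U_(gen_var (g i)) *+ e i)%MM.
Proof.
apply: (big_ind2 (fun a u => lead_mul a u)).
- exact: lead_mul1.
- by move=> *; apply: lead_mulM.
move=> i _; elim: (e i) => [|k IHk]; first by rewrite mulm0n; apply: lead_mul1.
by rewrite exprS mulmS; apply: lead_mulM IHk; apply: lead_mul_gen.
Qed.

Lemma lead_mul_pbw m : lead_mul (pbw q m) m.
Proof.
rewrite [X in lead_mul _ X]multinomUE_id !big_split_ord /=.
apply: lead_mulM; first apply: lead_mulM.
- exact: (lead_mul_prod (fun i => inr i) (fun i => m (zvar i))).
- exact: (lead_mul_prod (fun i => inl (inr i)) (fun i => m (yvar i))).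
- exact: (lead_mul_prod (fun i => inl (inl i)) (fun i => m (xvar i))).
Qed.

Lemma heis_coord_lead a b m k :
  lead_at (phi a) m -> lead_at (phi b) k -> lead_at (phi (a * b)) (m + k)%MM.
Proof.
case/lead_atP=> a_neq0 <- bk.
have -> : phi (a * b) = mlin (fun m => phi (pbw q m * b)) (phi a).
  rewrite -{1}(heis_coordK a) /heis_of_coord; move: (phi a).
  apply: mpoly_linear_ext => [||l]; [|exact: mlin_linear|by rewrite !mlinX].
  apply: linear_funcomp; first exact: (heis_coord_linear q_neq0).
  by move=> c u v; rewrite mlin_linear mulrDl scalerAl.
by apply: lead_at_mlin => // l; apply: lead_mul_pbw.
Qed.

End HeisenbergLead.

(** * Noetherianity *)

Section Dickson.

(** Each [g k.+1] is a place where [h] is minimal on the tail after [g k]; minima over shrinking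
    tails do not decrease. *)
Lemma nondecreasing_subsequence (h : nat -> nat) :
  exists g : nat -> nat, {homo g : i j / (i < j)%N} /\
    {homo (h \o g) : i j / (i <= j)%N}.
Proof.
have argmin i0 : exists i, (i0 <= i)%N /\ forall j, (i0 <= j)%N -> (h i <= h j)%N.
  pose good v := `[< exists i, (i0 <= i)%N /\ h i = v >].
  have ex_good : exists v, good v by exists (h i0); apply/asboolP; exists i0.
  case: (ex_minnP ex_good) => v /asboolP[i [le_i <-]] v_min.
  by exists i; split=> // j le_j; apply: v_min; apply/asboolP; exists j.
case: (choice argmin) => am amP.
pose g := fix g k := if k is l.+1 then am (g l).+1 else am 0%N.
have gS k : (g k < g k.+1)%N by case: (amP (g k).+1).
exists g; split; first exact: homo_ltn ltn_trans gS.
apply: homo_leq => [//|i j k|k]; first exact: leq_trans.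
have g_min j : (g k <= j)%N -> (h (g k) <= h j)%N.
  case: k => [|k] /= le_j; first by case: (amP 0%N) => _ ->.
  by case: (amP (g k).+1) => le_am -> //; apply: leq_trans le_j.
exact/g_min/ltnW.
Qed.

Lemma dickson_seq (I : eqType) (f : nat -> I -> nat) (s : seq I) :
  exists g : nat -> nat, {homo g : i j / (i < j)%N} /\
    forall v, v \in s -> {homo (fun i => f (g i) v) : i j / (i <= j)%N}.
Proof.
elim: s => [|v s [g [g_incr gP]]]; first by exists id; split.
have [h [h_incr hP]] := nondecreasing_subsequence (fun i => f (g i) v).
exists (g \o h); split; first by move=> i j /h_incr/g_incr.
move=> w; rewrite inE => /predU1P[->|/gP fw] i j le_ij; first exact: hP.
by apply: fw; move: le_ij; rewrite leq_eqVlt => /predU1P[->//|/h_incr/ltnW].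
Qed.

Lemma dickson (I : finType) (f : nat -> I -> nat) :
  exists i j, (i < j)%N /\ forall v, (f i v <= f j v)%N.
Proof.
have [g [g_incr gP]] := dickson_seq f (enum I).
exists (g 0%N), (g 1%N); split; first exact: g_incr.
by move=> v; apply: (gP v) => //; rewrite mem_enum.
Qed.

End Dickson.

Section Noetherian.
Import mpoly.
Variables (K : fieldType) (N : nat) (A : algType K).
Variables (phi : A -> {mpoly K[N]}) (psi : {mpoly K[N]} -> A).
Hypotheses (phi_linear : linear phi) (phiK : cancel phi psi) (psiK : cancel psi phi).
Hypothesis phi_lead : forall a b m k,
  lead_at (phi a) m -> lead_at (phi b) k -> lead_at (phi (a * b)) (m + k)%MM.

(** All that the chain condition uses of an ideal. Left and right ideals both have it, as
    multiplying by a monomial on either side adds exponents. *)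
Definition lead_shift_closed (I : set A) : Prop :=
  is_submod I /\ forall a m u, I a -> lead_at (phi a) m ->
    exists b, I b /\ lead_at (phi b) (u + m)%MM.

Lemma coord_eq0 a : phi a = 0 -> a = 0.
Proof. by move=> a0; rewrite -[LHS]phiK a0 -[0 in LHS](linear_fun0 phi_linear) phiK. Qed.

Lemma lead_at_coord a : a != 0 -> lead_at (phi a) (mlead (phi a)).
Proof.
by move=> a_neq0; apply/lead_atP; split=> //; apply: contra_neq a_neq0 => /coord_eq0.
Qed.

Lemma lead_atX m : lead_at (phi (psi 'X_[m])) m.
Proof. by rewrite psiK -[X in lead_at X]scale1r; apply: lead_at_X; rewrite oner_neq0. Qed.

Lemma minimal_lead (S : set A) a : S a ->
  exists2 b, S b & forall c, S c -> ~~ (mlead (phi c) < mlead (phi b))%O.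
Proof.
move=> Sa; move: {2}(mlead (phi a)) (erefl (mlead (phi a))) => m.
elim/(well_founded_ind (@ltom_wf N)): m a Sa => m IHm a Sa am.
have [[c Sc lt_c]|noc] := pselect (exists2 c, S c & (mlead (phi c) < m)%O).
  by apply: IHm lt_c c Sc erefl.
by exists a => // c Sc; rewrite am; apply/negP => lt_c; apply: noc; exists c.
Qed.

(** Otherwise choose [f k] in [I k.+1] outside [I k] with smallest leading monomial. By Dickson that
    of some [f i] divides that of a later [f j]. As [f i] lies in [I j], some [b] in [I j] has the
    leading monomial of [f j]; subtracting a multiple of [b] from [f j] contradicts minimality. *)
Lemma lead_shift_closed_acc (I : nat -> set A) :
  (forall k, lead_shift_closed (I k)) -> (forall k, I k `<=` I k.+1) ->
  exists k, I k.+1 `<=` I k.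
Proof.
move=> Ic Iincr; apply: contrapT => noacc.
have I0 k : I k 0 by case: (Ic k) => -[].
have /choice[f fP] k : exists a, [/\ I k.+1 a, ~ I k a &
    forall c, I k.+1 c -> ~ I k c -> ~~ (mlead (phi c) < mlead (phi a))%O].
  have /existsNP[a /not_implyP[Ia nIa]] : ~ (I k.+1 `<=` I k).
    by move=> le_k; apply: noacc; exists k.
  have [b [Ib nIb] bmin] := @minimal_lead [set a | I k.+1 a /\ ~ I k a] a (conj Ia nIa).
  by exists b; split=> // c Ic1 nIc; apply: bmin.
have f_neq0 k : f k != 0.
  by case: (fP k) => _ nI _; apply: contra_not_neq nI => ->.
have [i [j [lt_ij le_f]]] := dickson (fun k (v : 'I_N) => mlead (phi (f k)) v).
have Ile k l : (k <= l)%N -> I k `<=` I l.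
  move=> /subnKC <-; elim: (l - k)%N => [|d IHd]; first by rewrite addn0.
  by rewrite addnS; apply: subset_trans IHd (Iincr _).
have [If nIf fmin] := fP j.
have Ijfi : I j (f i) by case: (fP i) => If' _ _; apply: Ile If'.
have [[Ij0 IjD] Ijs] := Ic j; have [[_ Ij1D] _] := Ic j.+1.
have [b [Ib]] := Ijs _ _ (mlead (phi (f j)) - mlead (phi (f i)))%MM Ijfi (lead_at_coord (f_neq0 i)).
rewrite submK; last by apply/mnm_lepP.
set m := mlead (phi (f j)) => bm.
have [fm fgt] := lead_at_coord (f_neq0 j); have [bm0 bgt] := bm.
pose k := (phi (f j))@_m / (phi b)@_m.
pose c := - k *: b + f j.
have nIc : ~ I j c.
  move=> Ijc; apply: nIf; have -> : f j = k *: b + c.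
    by rewrite /c addrA -scalerDl subrr scale0r add0r.
  exact: IjD.
have Ic1 : I j.+1 c by apply: Ij1D => //; apply: Iincr.
have c_neq0 : c != 0 by apply: contra_not_neq nIc => ->.
have /negP := fmin c Ic1 nIc; apply; rewrite -/m.
have [cm _] := lead_at_coord c_neq0.
have phic l : (phi c)@_l = - k * (phi b)@_l + (phi (f j))@_l.
  by rewrite /c phi_linear mcoeffD mcoeffZ.
rewrite ltNge; apply/negP; rewrite le_eqVlt => /predU1P[mE|lt_m].
  by move: cm; rewrite -mE phic /k mulNr divfK // addNr eqxx.
by move: cm; rewrite phic bgt // fgt // mulr0 addr0 eqxx.
Qed.

(** Without a maximal member, choice would build a strictly increasing sequence in [F]. *)
Lemma ex_maximal_lead_shift_closed (F : set (set A)) (I0 : set A) :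
  F I0 -> (forall I, F I -> lead_shift_closed I) ->
  exists2 I, F I & forall J, F J -> I `<=` J -> J `<=` I.
Proof.
move=> FI0 Fc; apply: contrapT => nomax.
have next (I : {I | F I}) : exists J : {I | F I}, sval I `<=` sval J /\ ~ (sval J `<=` sval I).
  case: I => I FI /=; apply: contrapT => noJ; apply: nomax; exists I => // J FJ IJ.
  by apply: contrapT => nJI; apply: noJ; exists (exist _ J FJ).
case: (choice next) => nx nxP.
pose u k := iter k nx (exist _ I0 FI0).
have [||k le_k] := @lead_shift_closed_acc (fun k => sval (u k)).
- by move=> k; apply: Fc; apply: svalP.
- by move=> k; case: (nxP (u k)).
- by case: (nxP (u k)).
Qed.

Definition left_ideal (I : set A) : Prop :=
  is_submod I /\ forall r a, I a -> I (r * a).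
Definition right_ideal (I : set A) : Prop :=
  is_submod I /\ forall r a, I a -> I (a * r).

Lemma left_ideal_shift I : left_ideal I -> lead_shift_closed I.
Proof.
case=> Is Im; split=> // a m u Ia am; exists (psi 'X_[u] * a); split; first exact: Im.
exact/phi_lead/am/lead_atX.
Qed.

Lemma right_ideal_shift I : right_ideal I -> lead_shift_closed I.
Proof.
case=> Is Im; split=> // a m u Ia am; exists (a * psi 'X_[u]); split; first exact: Im.
by rewrite addmC; apply/phi_lead/lead_atX.
Qed.

Lemma ex_maximal_left_ideal (F : set (set A)) (I0 : set A) :
  F I0 -> (forall I, F I -> left_ideal I) ->
  exists2 I, F I & forall J, F J -> I `<=` J -> J `<=` I.
Proof.
by move=> FI0 Fl; apply: ex_maximal_lead_shift_closed FI0 _ => I /Fl/left_ideal_shift.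
Qed.

Lemma ex_maximal_right_ideal (F : set (set A)) (I0 : set A) :
  F I0 -> (forall I, F I -> right_ideal I) ->
  exists2 I, F I & forall J, F J -> I `<=` J -> J `<=` I.
Proof.
by move=> FI0 Fr; apply: ex_maximal_lead_shift_closed FI0 _ => I /Fr/right_ideal_shift.
Qed.

End Noetherian.

(** * Regular elements modulo a prime ideal *)

Section PrimeIdeals.
Variables (K : fieldType) (A : algType K).
Implicit Types (I J L P Q : set A).

Lemma two_sided_ideal_gen (S : set A) : two_sided_ideal (ideal_gen S).
Proof.
split=> [|a b|a r b]; [exact: ideal_gen0|exact: ideal_genD|exact: ideal_genMlr].
Qed.

Lemma two_sided_left I : two_sided_ideal I -> left_ideal I.
Proof.
case=> I0 ID IM; split=> [|r a /(IM r a 1)]; last by rewrite mulr1; apply.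
split=> // k u v Iu Iv; apply: ID => //.
by have := IM k%:A _ 1 Iu; rewrite mulr1 -scalerAl mul1r.
Qed.

Lemma two_sided_mulr I r a : two_sided_ideal I -> I a -> I (a * r).
Proof. by case=> _ _ IM /(IM 1 a r); rewrite mul1r. Qed.

(** Products from the ideals generated by [a] and by [b] are sums of terms [u * (a * r * b) * v]. *)
Lemma prime_ideal_elt P a b :
  prime_ideal P -> (forall r, P (a * r * b)) -> P a \/ P b.
Proof.
case=> [[P0 PD PM] PT Pprime] Pab.
have in_gen c : ideal_gen [set c] c.
  by exists 1%N, (fun=> 1), (fun=> c), (fun=> 1); rewrite big_ord1 mul1r mulr1.
have [|||gP|gP] := Pprime (ideal_gen [set a]) (ideal_gen [set b]).
- exact: two_sided_ideal_gen.
- exact: two_sided_ideal_gen.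
- move=> _ _ [m1 [a1 [s1 [b1 [S1 ->]]]]] [m2 [a2 [s2 [b2 [S2 ->]]]]].
  rewrite mulr_suml; apply: big_ind => // i _; rewrite mulr_sumr.
  apply: big_ind => // j _; rewrite (S1 i) (S2 j).
  have -> : a1 i * a * b1 i * (a2 j * b * b2 j) = a1 i * (a * (b1 i * a2 j) * b) * b2 j.
    by rewrite !mulrA.
  exact: PM.
- by left; apply: gP.
- by right; apply: gP.
Qed.

Lemma prime_ideal_not1 P : prime_ideal P -> ~ P 1.
Proof.
case=> [[P0 PD PM] PT _] P1; apply: PT; rewrite eqEsubset; split=> // a _.
by have := PM a 1 1 P1; rewrite !mulr1.
Qed.

Hypothesis max_left : forall (F : set (set A)) I0,
  F I0 -> (forall I, F I -> left_ideal I) ->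
  exists2 I, F I & forall J, F J -> I `<=` J -> J `<=` I.
Hypothesis max_right : forall (F : set (set A)) I0,
  F I0 -> (forall I, F I -> right_ideal I) ->
  exists2 I, F I & forall J, F J -> I `<=` J -> J `<=` I.

Variable P : set A.
Hypothesis P_prime : prime_ideal P.

Let P_ideal : two_sided_ideal P. Proof. by case: P_prime. Qed.
Let P_left : left_ideal P. Proof. exact: two_sided_left. Qed.
Let PMr a r : P a -> P (a * r). Proof. exact: two_sided_mulr. Qed.
Let PMl r a : P a -> P (r * a). Proof. by case: P_left => _; apply. Qed.

Definition lann (c : A) : set A := [set b | P (b * c)].
Definition rann (c : A) : set A := [set b | P (c * b)].

Lemma lann_left c : left_ideal (lann c).
Proof.
case: P_left => -[P0 PD] PM; split=> [|r a]; last by rewrite /lann /= -mulrA; apply: PM.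
split=> [|k u v]; rewrite /lann /= ?mul0r //.
by rewrite mulrDl -scalerAl; apply: PD.
Qed.

Lemma rann_right c : right_ideal (rann c).
Proof.
case: P_left => -[P0 PD] _; split=> [|r a]; last by rewrite /rann /= mulrA; apply: PMr.
split=> [|k u v]; rewrite /rann /= ?mulr0 //.
by rewrite mulrDr -scalerAr; apply: PD.
Qed.

(* Levitzki's argument: a nonzero element [a] of a nil left ideal with maximal
   right annihilator satisfies [a A a = 0]. *)
Lemma ex_non_nilpotent L a0 : left_ideal L -> L a0 -> ~ P a0 ->
  exists2 a, L a & forall k, ~ P (a ^+ k).
Proof.
move=> [[L0 LD] LM] La0 nPa0; apply: contrapT => L_nil.
have nil a : L a -> exists k, P (a ^+ k).
  by move=> La; apply: contrapT => nk; apply: L_nil; exists a => // k Pk; apply: nk; exists k.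
pose F := [set J | exists2 a, L a /\ ~ P a & J = rann a].
have [_ [a [La nPa] ->] a_max] : exists2 J, F J & forall J', F J' -> J `<=` J' -> J' `<=` J.
  apply: (@max_right F (rann a0)); first by exists a0.
  by move=> _ [a _ ->]; apply: rann_right.
have aba b : P (a * b * a).
  have [Pba|nPba] := pselect (P (b * a)); first by rewrite -mulrA; apply: PMl.
  pose good k := `[< P ((b * a) ^+ k) >].
  have [k0 Pk0] : exists k, P ((b * a) ^+ k) by apply/nil/LM.
  have ex_good : exists k, good k by exists k0; apply/asboolP.
  case: (ex_minnP ex_good) => -[|[|k]] /asboolP Pk k_min.
  - by case: (prime_ideal_not1 P_prime).
  - by case: nPba; rewrite -[b * a]expr1.
  (* The last power of [b * a] outside [P]. It ends in [a], so its right annihilator contains that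
     of [a] and equals it by maximality; since [c * (b * a)] is in [P], so is [a * (b * a)]. *)
  pose c := (b * a) ^+ k.+1.
  have Lc : L c by rewrite /c exprSr mulrA; apply: LM.
  have nPc : ~ P c.
    by move=> Pc; have := k_min k.+1; rewrite ltnn => /(_ (asboolT Pc)).
  have le_ac : rann a `<=` rann c.
    by move=> r; rewrite /rann /= /c exprSr -!mulrA => /(PMl ((b * a) ^+ k * b)); rewrite !mulrA.
  have : rann c (b * a) by rewrite /rann /= /c -exprSr.
  by move/(a_max (rann c) (ex_intro2 _ _ c (conj Lc nPc) erefl) le_ac); rewrite /rann /= mulrA.
by case: (prime_ideal_elt P_prime aba).
Qed.

(** The left annihilators of the powers of a non-nilpotent element increase; at a power where the
    annihilator is maximal, squaring no longer enlarges it. *)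
Lemma ex_stable_lann L a0 : left_ideal L -> L a0 -> ~ P a0 ->
  exists a, [/\ L a, ~ P a & lann (a * a) `<=` lann a].
Proof.
move=> Ll La0 /(ex_non_nilpotent Ll La0)[a La nPa].
pose F := [set J | exists k, J = lann (a ^+ k.+1)].
have [_ [k ->] k_max] : exists2 J, F J & forall J', F J' -> J `<=` J' -> J' `<=` J.
  apply: (@max_left F (lann (a ^+ 1))); first by exists 0%N.
  by move=> _ [k ->]; apply: lann_left.
exists (a ^+ k.+1); split=> //.
  by rewrite exprSr; case: Ll => _; apply.
apply: k_max; first by exists (k + k.+1)%N; rewrite -exprD.
by move=> r; rewrite /lann /= mulrA; apply: PMr.
Qed.

(* Goldie: take [L] maximal among the left ideals of [Q] meeting [lann c] only
   in [P], for some [c] in [L]; an element of [Q] left-annihilating [c] and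
   outside [P] would enlarge [L]. *)
Lemma ex_regular Q q0 : two_sided_ideal Q -> P `<=` Q -> Q q0 -> ~ P q0 ->
  exists2 c, Q c & lann c `<=` P.
Proof.
move=> Q_ideal PQ Qq0 nPq0; have [[Q0 QD] QM] := two_sided_left Q_ideal.
pose F := [set L | [/\ left_ideal L, L `<=` Q &
  exists2 c, L c & forall a, L a -> lann c a -> P a]].
have [L [Ll LQ [c Lc cP]] L_max] : exists2 L, F L & forall J, F J -> L `<=` J -> J `<=` L.
  apply: (@max_left F P); last by move=> L [].
  by split=> //; exists 0 => //; case: P_ideal.
have [[L0 LD] LM] := Ll; have Qc : Q c by apply: LQ.
(* Cancelling [c] inside [Q] suffices: if [b * c] is in [P], all [q0 * r * b] lie in [Q] and
   annihilate [c], hence lie in [P], and primeness puts [b] in [P]. *)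
suff QcP a : Q a -> lann c a -> P a.
  exists c => // b Pbc.
  have [|/nPq0//|//] := @prime_ideal_elt P q0 b P_prime.
  move=> r; apply: QcP; last by rewrite /lann /= -mulrA; apply: PMl.
  by apply: two_sided_mulr => //; apply: two_sided_mulr.
move=> Qa0 ca0; apply: contrapT => nPa0.
have Qc_left : left_ideal (Q `&` lann c).
  have [[_ cD] cM] := lann_left c; split=> [|r b [Qb cb]]; last first.
    by split; [apply: QM|apply: cM].
  split=> [|k u v [Qu cu] [Qv cv]]; last by split; [apply: QD|apply: cD].
  by split=> //; rewrite /lann /= mul0r; case: P_ideal.
have [a' [[Qa ca] nPa a_stable]] := ex_stable_lann Qc_left (conj Qa0 ca0) nPa0.
have PB u v : P u -> P (u + v) -> P v.
  move=> Pu Puv; have [[_ PD] _] := P_left.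
  by have := PD (-1) _ _ Pu Puv; rewrite scaleN1r addKr.
have PD u v : P u -> P v -> P (u + v) by case: P_ideal => _ + _; apply.
pose L' := [set x | exists l b, L l /\ x = l + b * a'].
have L'a : L' a' by exists 0, 1; rewrite add0r mul1r.
have LL' : L `<=` L' by move=> l Ll'; exists l, 0; rewrite mul0r addr0.
have FL' : F L'.
  split.
  - split=> [|r _ [l [b [Ll' ->]]]]; last first.
      by exists (r * l), (r * b); rewrite mulrDr mulrA; split=> //; apply: LM.
    split=> [|k _ _ [l1 [b1 [L1 ->]]] [l2 [b2 [L2 ->]]]]; first exact: LL'.
    exists (k *: l1 + l2), (k *: b1 + b2); split; first exact: LD.
    by rewrite scalerDr mulrDl scalerAl addrACA.
  - move=> _ [l [b [Ll' ->]]]; case: Q_ideal => _ QD' _.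
    by apply: QD'; [apply: LQ|apply: QM].
  (* Let [(l + b * a') * (c + a')] be in [P]. Since [a' * c] is in [P], a further factor [c] on the
     right leaves [l * c * c] in [P], so [l] is in [P] by [cP] used twice. What remains is
     [b * (a' * a')] in [P], and stability of [a'] gives [b * a'] in [P]. *)
  exists (c + a'); first by exists c, 1; rewrite mul1r.
  move=> _ [l [b [Ll' ->]]]; rewrite /lann /= => Pca.
  have Pl : P l.
    apply: (cP) => //; apply: (cP); first exact: LM.
    have Pcac : P (b * (a' * c) * c + (l + b * a') * (a' * c) + l * c * c).
      have := PMr c Pca.
      by rewrite mulrDr mulrDl mulrDl mulrDl !mulrA -addrA addrC.
    apply: (PB) Pcac; apply: (PD); last exact: PMl.
    exact/PMr/PMl.
  apply: (PD) => //; apply: (a_stable); rewrite /lann /=.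
  have Pca' : P (l * (c + a') + b * (a' * c) + b * (a' * a')).
    by move: Pca; rewrite mulrDl [b * a' * _]mulrDr -addrA !mulrA.
  by apply: (PB) Pca'; apply: (PD); [apply: PMr|apply: PMl].
by apply: nPa; apply: cP => //; apply: L_max L'a.
Qed.

End PrimeIdeals.

(** * Growth modulo prime ideals *)

Section BinomialBounds.
Local Open Scope nat_scope.

Lemma bin_addS k d : k.+1 * 'C(k.+1 + d, k.+1) = (k.+1 + d) * 'C(k + d, k).
Proof. by rewrite addSn -mul_bin_diag. Qed.

Lemma bin_le_expn k d : 'C(k + d, k) <= d.+1 ^ k.
Proof.
elim: k => [|k IHk]; first by rewrite bin0.
rewrite -(@leq_pmul2l k.+1) // bin_addS expnS.
by rewrite mulnA; apply: leq_mul => //; nia.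
Qed.

Lemma expn_le_bin k d : d.+1 ^ k <= k`! * 'C(k + d, k).
Proof.
elim: k => [|k IHk]; first by rewrite bin0.
rewrite factS [k.+1 * _]mulnC -mulnA bin_addS expnS mulnCA.
by apply: leq_mul => //; lia.
Qed.

End BinomialBounds.

Section Filtration.
Import mpoly.
Variables (K : fieldType) (N : nat) (A : lmodType K).
Variables (phi : A -> {mpoly K[N]}) (psi : {mpoly K[N]} -> A).
Hypotheses (phi_linear : linear phi) (phiK : cancel phi psi) (psiK : cancel psi phi).

Lemma psi_linear : linear psi.
Proof. by move=> k u v; rewrite -{1}(psiK u) -{1}(psiK v) -phi_linear phiK. Qed.

Definition supported (M : set 'X_{1..N}) : set A :=
  [set a | forall m, m \in msupp (phi a) -> M m].

Lemma supported_submod M : is_submod (supported M).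
Proof.
split=> [m|k u v Mu Mv m]; first by rewrite (linear_fun0 phi_linear) msupp0.
rewrite phi_linear => /msuppD_le; rewrite mem_cat => /orP[/msuppZ_le /Mu //|/Mv //].
Qed.

Lemma supported_basis (M : set 'X_{1..N}) (k : nat) (f : 'I_k -> 'X_{1..N}) :
  injective f -> (forall m, M m <-> exists i, f i = m) ->
  is_basis (supported M) (fun i => psi 'X_[f i]).
Proof.
move=> f_inj Mf; split=> [|c].
  rewrite eqEsubset; split.
    apply: lspan_min; first exact: supported_submod.
    move=> _ [i _ <-] m; rewrite psiK => /mem_msuppXP <-.
    by apply/Mf; exists i.
  move=> a Ma; rewrite -(phiK a) (mpolyE (phi a)) (linear_lincomb _ _ _ psi_linear).
  rewrite big_seq_cond; apply: big_ind => [|u v Su Sv|m /andP[/Ma/Mf[i <-] _]].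
  - by case: (lspan_submod (range (fun i => psi 'X_[f i]))).
  - by rewrite -[u]scale1r; case: (lspan_submod (range (fun i => psi 'X_[f i]))) => _; apply.
  rewrite -[_ *: _]addr0; case: (lspan_submod (range (fun i => psi 'X_[f i]))) => S0; apply => //.
  by apply: sub_lspan; exists i.
move=> /(congr1 phi); rewrite (linear_lincomb _ _ _ phi_linear) (linear_fun0 phi_linear).
move=> c0 i; have := congr1 (mcoeff (f i)) c0.
rewrite mcoeff0 raddf_sum /= (bigD1 i) //= big1 ?addr0 => [|j ji].
  by rewrite mcoeffZ psiK mcoeffX eqxx mulr1.
by rewrite mcoeffZ psiK mcoeffX (inj_eq f_inj) (negPf ji) mulr0.
Qed.

Section TupleMonomials.
Variables (d : nat) (S : {set N.-tuple 'I_d.+1}).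

(** Exponents of a monomial of degree at most [d] are ordinals below [d.+1]; this reduces the
    dimension counts to the known numbers of tuples with prescribed or bounded sum. *)
Definition tuple_mon (i : 'I_#|S|) : 'X_{1..N} :=
  [multinom (tnth (enum_val i) j : nat) | j < N].

Lemma tuple_mon_inj : injective tuple_mon.
Proof.
move=> i j ij; apply: enum_val_inj; apply: eq_from_tnth => l; apply: val_inj.
by have := congr1 (fun m : 'X_{1..N} => m l) ij; rewrite !mnmE.
Qed.

Lemma mdeg_tuple_mon i : mdeg (tuple_mon i) = (\sum_(j <- enum_val i) j)%N.
Proof. by rewrite mdegE big_tuple; apply: eq_bigr => j _; rewrite mnmE. Qed.

Lemma ex_tuple_mon (m : 'X_{1..N}) : (mdeg m <= d)%N ->
  (forall t : N.-tuple 'I_d.+1, (\sum_(j <- t) j)%N = mdeg m -> t \in S) ->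
  exists i, tuple_mon i = m.
Proof.
move=> le_md inS; pose t := [tuple (inord (m j) : 'I_d.+1) | j < N].
have tE j : tnth t j = m j :> nat.
  rewrite tnth_mktuple inordK // ltnS (leq_trans _ le_md) // mdegE.
  by rewrite (bigD1 j) //= leq_addr.
have tS : t \in S.
  by apply: inS; rewrite big_tuple mdegE; apply: eq_bigr => j _; rewrite tE.
exists (enum_rank_in tS t); apply/mnmP => j.
by rewrite mnmE enum_rankK_in.
Qed.

End TupleMonomials.

Definition filt (d : nat) : set A := supported [set m | (mdeg m <= d)%N].

Lemma filtE d a : filt d a <-> (msize (phi a) <= d.+1)%N.
Proof.
split=> [da|le_d m /msize_mdeg_lt lt_m]; last by rewrite /= -ltnS (leq_trans lt_m).
by rewrite msizeE; apply/bigmax_leqP_seq => m mp _; apply: da.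
Qed.

Lemma filt_basis d : exists b : 'I_'C(N + d, N) -> A, is_basis (filt d) b.
Proof.
rewrite -card_partial_ord_partitions; set S := [set t | _]%SET.
eexists; apply: (@supported_basis _ _ (@tuple_mon d S)); first exact: tuple_mon_inj.
move=> m; split=> [dm|[i <-]].
  by apply: ex_tuple_mon => // t tm; rewrite inE tm.
by rewrite /= mdeg_tuple_mon; have := enum_valP i; rewrite inE.
Qed.

Lemma homogeneous_basis d N' : N = N'.+1 ->
  exists b : 'I_'C(N' + d, N') -> A, is_basis (supported [set m | mdeg m = d]) b.
Proof.
move=> NE; rewrite -card_ord_partitions -NE; set S := [set t | _]%SET.
eexists; apply: (@supported_basis _ _ (@tuple_mon d S)); first exact: tuple_mon_inj.
move=> m; split=> [dm|[i <-]].
  by apply: ex_tuple_mon => [|t tm]; rewrite ?dm // inE tm dm.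
by rewrite /= mdeg_tuple_mon; have := enum_valP i; rewrite inE => /eqP.
Qed.

End Filtration.

Section IndependentPowers.
Variables (K : fieldType) (A : algType K).

Lemma indep_mod_fin (P : set A) (T : finType) (F : T -> A) :
  (forall c : T -> K, P (\sum_t c t *: F t) -> forall t, c t = 0) ->
  indep_mod P (fun i : 'I_#|T| => F (enum_val i)).
Proof.
move=> F_free c Pc i; rewrite -(enum_valK i).
apply: (F_free (fun t => c (enum_rank t))).
rewrite (reindex (@enum_val T T)) /=; last first.
  by exists enum_rank => t _; [apply: enum_valK|apply: enum_rankK].
by under eq_bigr do rewrite enum_valK.
Qed.

Variables (P Q : set A) (c : A).
Hypotheses (P_left : left_ideal P) (Q_left : left_ideal Q).
Hypotheses (PQ : P `<=` Q) (Qc : Q c) (c_reg : lann P c `<=` P).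

(* Modulo [Q] the relation reduces to its constant term, which therefore
   vanishes; the rest is divisible by [c] on the right. *)
Lemma indep_mod_powers (r : nat) (w : 'I_r -> A) : indep_mod Q w ->
  forall l (k : nat -> 'I_r -> K), P (\sum_(j < l) (\sum_i k j i *: w i) * c ^+ j) ->
  forall j, (j < l)%N -> forall i, k j i = 0.
Proof.
move=> w_free; elim=> [//|l IHl] k; rewrite big_ord_recl mulr1.
have [[Q0 QD] QM] := Q_left.
set e0 := \sum_i _ *: _; set e := \sum_(j < l) _ => Pe.
have eE : e = (\sum_(j < l) (\sum_i k j.+1 i *: w i) * c ^+ j) * c.
  by rewrite mulr_suml; apply: eq_bigr => j _; rewrite -mulrA -exprSr.
have Qe : Q e by rewrite eE; apply: QM.
have k0 i : k 0%N i = 0.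
  apply: w_free; rewrite -/e0; have /PQ Qe0 := Pe.
  by have := QD (-1) _ _ Qe Qe0; rewrite scaleN1r addrC addrK.
have e00 : e0 = 0 by apply: big1 => i _; rewrite k0 scale0r.
rewrite e00 add0r eE in Pe; have Pk := c_reg Pe.
by case=> [//|j] lt_j i; apply: (IHl (fun j => k j.+1)).
Qed.

End IndependentPowers.

Section GrowthModuloPrimes.
Import mpoly.
Variables (K : fieldType) (N : nat) (A : algType K).
Variables (phi : A -> {mpoly K[N]}) (psi : {mpoly K[N]} -> A).
Hypotheses (phi_linear : linear phi) (phiK : cancel phi psi) (psiK : cancel psi phi).
Hypothesis phi1 : phi 1 = 1.
Hypothesis phi_lead : forall a b m k,
  lead_at (phi a) m -> lead_at (phi b) k -> lead_at (phi (a * b)) (m + k)%MM.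

Local Notation filt := (filt phi).

Lemma filt1 d : filt d 1.
Proof. by move=> m; rewrite phi1 msupp1 inE => /eqP -> /=; rewrite mdeg0. Qed.

Lemma filt_mono d e : (d <= e)%N -> filt d `<=` filt e.
Proof. by move=> le_de a da m /da /= /leq_trans; apply. Qed.

Lemma ex_filt a : exists d, filt d a.
Proof. by exists (msize (phi a)); apply/filtE. Qed.

(** In a degree-first order the leading monomial carries the degree, so degrees add because leading
    monomials do. *)
Lemma filtM d e a b : filt d a -> filt e b -> filt (d + e)%N (a * b).
Proof.
have [->|a_neq0] := eqVneq a 0.
  by rewrite mul0r => _ _ m; rewrite (linear_fun0 phi_linear) msupp0.
have [->|b_neq0] := eqVneq b 0.
  by rewrite mulr0 => _ _ m; rewrite (linear_fun0 phi_linear) msupp0.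
move=> da eb; have al := lead_at_coord phi_linear phiK a_neq0.
have bl := lead_at_coord phi_linear phiK b_neq0.
have /lead_atP[ab_neq0 abl] := phi_lead al bl.
apply/filtE; rewrite -mlead_deg // abl mdegD ltnS leq_add //.
  by apply: da; rewrite mcoeff_msupp; case: al.
by apply: eb; rewrite mcoeff_msupp; case: bl.
Qed.

Lemma filtX d a j : filt d a -> filt (j * d)%N (a ^+ j).
Proof.
move=> da; elim: j => [|j IHj]; first exact: filt1.
by rewrite exprS mulSn; apply: filtM.
Qed.

(* [growth_mod P s]: the quotient filtration on [A / P] has dimensions
   [O(d ^ s)]. *)
Definition growth_mod (P : set A) (s : nat) : Prop :=
  exists C, forall d k (b : 'I_k -> A),
    (forall i, filt d (b i)) -> indep_mod P b -> (k <= C * d.+1 ^ s)%N.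

Lemma growth_mod_base P : P 0 -> growth_mod P N.
Proof.
move=> P0; exists 1%N => d k b db b_free; rewrite mul1n.
apply: leq_trans (bin_le_expn N d).
have [b' [b'_span _]] := filt_basis phi_linear phiK psiK d.
apply: (indep_span_le (v := b') (b := b)) => [i|]; first by rewrite b'_span.
by move=> c c0; apply: b_free; rewrite c0.
Qed.

(** The [d.+1 * k] elements [b i * c ^+ j] with [j <= d] have degree at most [d + d * e] and are
    independent modulo [P]. The constant comes from [(d + d * e).+1 <= e.+1 * d.+1]. *)
Lemma growth_mod_powers P Q c s e :
  left_ideal P -> left_ideal Q -> P `<=` Q -> Q c -> lann P c `<=` P -> filt e c ->
  growth_mod P s ->
  exists C, forall d k (b : 'I_k -> A),
    (forall i, filt d (b i)) -> indep_mod Q b -> (d.+1 * k <= C * d.+1 ^ s)%N.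
Proof.
move=> Pl Ql PQ Qc c_reg ec [C PC]; exists (C * e.+1 ^ s)%N => d k b db b_free.
pose F (t : 'I_d.+1 * 'I_k) := b t.2 * c ^+ t.1.
have Fd t : filt (d + d * e)%N (F t).
  apply: filtM => //; apply: (@filt_mono (t.1 * e)%N); last exact: filtX.
  by rewrite leq_mul // -ltnS.
have F_free (u : 'I_d.+1 * 'I_k -> K) : P (\sum_t u t *: F t) -> forall t, u t = 0.
  pose u' j i := if insub j is Some j' then u (j', i) else 0.
  have u'E (j : 'I_d.+1) i : u' j i = u (j, i) by rewrite /u' valK.
  have -> : \sum_t u t *: F t = \sum_(j < d.+1) (\sum_i u' j i *: b i) * c ^+ j.
    under [RHS]eq_bigr do rewrite mulr_suml.
    rewrite pair_bigA; apply: eq_bigr => -[j i] _.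
    by rewrite /F /= u'E scalerAl.
  move=> /(indep_mod_powers Ql PQ Qc c_reg b_free) u0 [j i].
  by rewrite -u'E; apply: u0.
have := PC (d + d * e)%N _ _ (fun i => Fd (enum_val i)) (indep_mod_fin F_free).
rewrite card_prod !card_ord => /leq_trans; apply.
rewrite -mulnA leq_mul2l; apply/orP; right.
by rewrite -expnMn; case: (s) => // s'; rewrite leq_exp2r //; nia.
Qed.

Lemma growth_mod_drop P Q c s :
  left_ideal P -> left_ideal Q -> P `<=` Q -> Q c -> lann P c `<=` P ->
  growth_mod P s.+1 -> growth_mod Q s.
Proof.
move=> Pl Ql PQ Qc c_reg PC; have [e ec] := ex_filt c.
have [C QC] := growth_mod_powers Pl Ql PQ Qc c_reg ec PC.
exists C => d k b db b_free.
by rewrite -(@leq_pmul2l d.+1) // mulnCA -expnS; apply: QC db b_free.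
Qed.

(** If [1] were outside [Q], it would form a one-element family independent modulo [Q], and the
    bound of [growth_mod_powers] at [d = C] would read [C.+1 <= C]. *)
Lemma growth_mod0 P Q c :
  left_ideal P -> left_ideal Q -> P `<=` Q -> Q c -> lann P c `<=` P ->
  growth_mod P 0 -> Q 1.
Proof.
move=> Pl Ql PQ Qc c_reg PC; have [e ec] := ex_filt c; apply: contrapT => nQ1.
have [C QC] := growth_mod_powers Pl Ql PQ Qc c_reg ec PC.
have := QC C 1%N (fun=> 1) (fun=> filt1 _).
rewrite expn0 !muln1 ltnn => /(_ _)/notF; apply.
move=> u; rewrite big_ord1 => Qu i; rewrite ord1; apply: contrapT => /eqP u_neq0.
case: Ql => _ /(_ (u ord0)^-1%:A _ Qu).
by rewrite -scalerAl mul1r scalerA mulVf ?scale1r.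
Qed.

(** The invariant is growth exponent [N - i] for [Pc i]. As this subtraction is truncated, [i <= N]
    is carried along: at [i = N] the exponent is 0 and the next prime would contain [1]. *)
Lemma prime_chain_le m (Pc : nat -> set A) : prime_chain m Pc -> (m <= N)%N.
Proof.
move=> [Pprime Plt].
suff : forall i, (i <= m)%N -> (i <= N)%N /\ growth_mod (Pc i) (N - i).
  by move/(_ m (leqnn m)) => [].
have Pl i : (i <= m)%N -> left_ideal (Pc i).
  by move=> /Pprime[] /two_sided_left.
elim=> [|i IHi] lt_im.
  split=> //; rewrite subn0; apply: growth_mod_base.
  by have [[]] := Pl _ lt_im.
have [le_iN Pi] := IHi (ltnW lt_im).
have [PQ /existsNP[q0 /not_implyP[Qq0 nPq0]]] : (Pc i `<=` Pc i.+1) /\ ~ (Pc i.+1 `<=` Pc i).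
  exact: Plt.
have [c Qc c_reg] := ex_regular (ex_maximal_left_ideal phi_linear phiK psiK phi_lead)
  (ex_maximal_right_ideal phi_linear phiK psiK phi_lead) (Pprime _ (ltnW lt_im))
  (let: And3 Qi _ _ := Pprime _ lt_im in Qi) PQ Qq0 nPq0.
have lt_iN : (i < N)%N.
  rewrite ltn_neqAle le_iN andbT; apply/eqP => iN; rewrite iN subnn -iN in Pi.
  apply: (prime_ideal_not1 (Pprime _ lt_im)).
  exact: growth_mod0 (Pl _ (ltnW lt_im)) (Pl _ lt_im) PQ Qc c_reg Pi.
split=> //; apply: growth_mod_drop (Pl _ (ltnW lt_im)) (Pl _ lt_im) PQ Qc c_reg _.
by rewrite subnSK.
Qed.

End GrowthModuloPrimes.

(** * A chain of completely prime ideals *)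

Section CompletelyPrime.
Variables (K : fieldType) (A : algType K).

Lemma completely_prime (P : set A) : two_sided_ideal P -> ~ P 1 ->
  (forall a b, P (a * b) -> P a \/ P b) -> prime_ideal P.
Proof.
move=> P_ideal nP1 Pab; split=> // [PT|I J _ _ IJ]; first by apply: nP1; rewrite PT.
have [IP|/existsNP[a /not_implyP[Ia nPa]]] := pselect (I `<=` P); first by left.
by right=> b Jb; case: (Pab _ _ (IJ a b Ia Jb)).
Qed.

(* A two-sided ideal when [L] is a left ideal. *)
Definition absorbed (L : set A) : set A := [set a | forall b, L (a * b)].

Lemma absorbed_prod (L : set A) (I : eqType) (r : seq I) (F : I -> A) i :
  (forall r a, L a -> L (r * a)) -> i \in r -> absorbed L (F i) ->
  absorbed L (\prod_(j <- r) F j).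
Proof.
move=> LM ir Fi b; elim: r ir b => [//|j r IHr]; rewrite inE big_cons => /predU1P[<-|/IHr Lr] b.
  by rewrite -mulrA.
by rewrite -mulrA; apply: LM.
Qed.

Lemma absorbedM (L : set A) u a v :
  (forall r a, L a -> L (r * a)) -> absorbed L a -> absorbed L (u * a * v).
Proof. by move=> LM La b; rewrite -!mulrA; apply: LM; apply: La. Qed.

(** Shows that [c * d] and [a * b] agree modulo an ideal containing [a - c] and [b - d], in the
    shape [k *: u + v] of the closure condition of a subspace. *)
Lemma mul_split (a b c d : A) :
  c * d = -1 *: ((a - c) * b) + (a * b + (-1 *: (c * (b - d)) + 0)).
Proof.
rewrite addr0 !scaleN1r mulrBl mulrBr !opprB addrA subrK.
by rewrite addrCA subrr addr0.
Qed.

End CompletelyPrime.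

Section HeisenbergPrimes.
Import mpoly.
Variables (K : fieldType) (n : nat) (q : K).
Hypothesis q_neq0 : q != 0.

Local Notation N := (n + n + n)%N.
Local Notation P := {mpoly K[N]}.
Local Notation H := (heis n q).
Local Notation phi := (@heis_coord K n q).
Local Notation psi := (@heis_of_coord K n q).

Definition meets (j : nat) : set 'X_{1..N} := [set m | exists2 v : 'I_N, (v < j)%N & m v != 0%N].

(** Described by PBW support instead of by generators, so that membership is read off coefficients;
    stability under multiplication becomes the point to prove. *)
Definition first_vars_ideal (j : nat) : set H := supported phi (meets j).

Let spanP (M : set 'X_{1..N}) : is_submod (supported (@idfun P) M).
Proof. exact: supported_submod. Qed.

Lemma supported_mlin (M M' : set 'X_{1..N}) (F : 'X_{1..N} -> P) (p : P) :
  (forall m, M m -> supported idfun M' (F m)) -> supported idfun M p ->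
  supported idfun M' (mlin F p).
Proof.
move=> FM pM; rewrite /mlin big_seq_cond; have [M0 MD] := spanP M'.
apply: big_ind => [//|u v Mu Mv|m /andP[/pM/FM Fm _]].
  by rewrite -[u]scale1r; apply: MD.
by rewrite -[_ *: _]addr0; apply: MD.
Qed.

Lemma supported_X (M : set 'X_{1..N}) m c : M m -> supported idfun M (c *: 'X_[m] : P).
Proof. by move=> Mm l /= /msuppZ_le /mem_msuppXP <-. Qed.

Lemma supported_xmon (M : set 'X_{1..N}) i m :
  M (m + U_(xvar i))%MM -> (m (yvar i) != 0%N -> M (m + U_(zvar i) - U_(yvar i))%MM) ->
  supported idfun M (xmon q i m).
Proof.
move=> Mx Mz; rewrite /xmon; have [M0 MD] := spanP M.
rewrite -[_ *: 'X_[m + U_(xvar i)]]scale1r; apply: MD; first exact: supported_X.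
have [my0|my] := eqVneq (m (yvar i)) 0%N; last by apply: supported_X; apply: Mz.
by rewrite my0 scoef0 mulr0 scale0r; exact: M0.
Qed.

Lemma zvar_lt (i : 'I_n) : (zvar i < n)%N.
Proof. by rewrite /zvar /=. Qed.

Lemma yvar_ge (i : 'I_n) : (n <= yvar i)%N.
Proof. by rewrite /yvar /= leq_addr. Qed.

Lemma mnm_sub_yvar (m : 'X_{1..N}) (i : 'I_n) v : v != yvar i ->
  (m + U_(zvar i) - U_(yvar i))%MM v = (m v + (zvar i == v))%N.
Proof. by move=> vy; rewrite mnmBE mnmDE !mnm1E [yvar i == v]eq_sym (negPf vy) subn0. Qed.

(** The correction term of [x_i] removes a [y_i] but creates a [z_i], and the z's precede the
    y's. *)
Lemma meets_z_sub_y j (i : 'I_n) m : (yvar i < j)%N -> meets j (m + U_(zvar i) - U_(yvar i))%MM.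
Proof.
move=> lt_j; exists (zvar i).
  exact: ltn_trans (leq_trans (zvar_lt i) (yvar_ge i)) lt_j.
by rewrite mnm_sub_yvar ?var_eqE // eqxx addn1.
Qed.

Lemma meets_add j (m u : 'X_{1..N}) : meets j m -> meets j (m + u)%MM.
Proof. by move=> [w wj mw]; exists w => //; rewrite mnmDE addn_eq0 negb_and mw. Qed.

Lemma first_vars_gen j g a :
  first_vars_ideal j a -> first_vars_ideal j (heis_gen q g * a).
Proof.
move=> ja; suff: supported idfun (meets j) (gen_step q g (phi a)).
  by rewrite -heis_coord_gen.
case: g => [[]|] i; apply: supported_mlin ja => m jm.
- apply: supported_xmon; first exact: meets_add.
  case: jm => w wj mw my; have [wy|wy] := eqVneq w (yvar i).
    by apply: meets_z_sub_y; rewrite -wy.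
  by exists w => //; rewrite mnm_sub_yvar // addn_eq0 negb_and mw.
- by apply: supported_X; apply: meets_add.
- by rewrite -[zmon _ _ _]scale1r; apply: supported_X; apply: meets_add.
Qed.

Lemma first_vars_absorbed j g a :
  (gen_var g < j)%N -> first_vars_ideal j (heis_gen q g * a).
Proof.
move=> lt_j; suff: supported idfun (meets j) (gen_step q g (phi a)).
  by rewrite -heis_coord_gen.
have meets_U m : meets j (m + U_(gen_var g))%MM.
  by exists (gen_var g) => //; rewrite mnmDE mnm1E eqxx addn1.
case: g lt_j meets_U => [[]|] i /= lt_j meets_U;
  apply: (@supported_mlin setT) => // m _.
- apply: supported_xmon => // _; apply/meets_z_sub_y.
  by apply: leq_trans lt_j; rewrite ltnS /= leq_add2r leq_addr.
- exact: supported_X.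
- by rewrite -[zmon _ _ _]scale1r; apply: supported_X.
Qed.

Lemma first_vars_left j : left_ideal (first_vars_ideal j).
Proof.
have jS : is_submod (first_vars_ideal j) by apply/supported_submod/heis_coord_linear.
split=> // r a ja; rewrite -[r]heis_coordK; move: (phi r) => p.
have jpbw m : first_vars_ideal j (pbw q m * a).
  have jprod (g : 'I_n -> 'I_n + 'I_n + 'I_n) (e : 'I_n -> nat) b : first_vars_ideal j b ->
      first_vars_ideal j ((\prod_i heis_gen q (g i) ^+ e i) * b).
    elim: (index_enum _) b => [|i s IHs] b jb; first by rewrite big_nil mul1r.
    rewrite big_cons -mulrA; elim: (e i) => [|k IHk]; first by rewrite mul1r; apply: IHs.
    by rewrite exprS -mulrA; apply: first_vars_gen.
  rewrite /pbw /pbw_monomial -!mulrA.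
  apply: (jprod (fun i => inr i)); apply: (jprod (fun i => inl (inr i))).
  exact: (jprod (fun i => inl (inl i))).
rewrite /heis_of_coord /mlin mulr_suml; have [j0 jD] := jS.
apply: big_ind => [//|u v ju jv|m _]; first by rewrite -[u]scale1r; apply: jD.
by rewrite -scalerAl -[_ *: _]addr0; apply: jD.
Qed.

Lemma pbw_absorbed j m : meets j m -> absorbed (first_vars_ideal j) (pbw q m).
Proof.
move=> [v lt_vj mv]; have [_ LM] := first_vars_left j.
have gen_absorbed g k : (gen_var g < j)%N -> k != 0%N ->
    absorbed (first_vars_ideal j) (heis_gen q g ^+ k).
  move=> lt_j; case: k => // k _ b; rewrite exprS -mulrA.
  exact: first_vars_absorbed.
have prod_absorbed (g : 'I_n -> 'I_n + 'I_n + 'I_n) (e : 'I_n -> nat) i :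
    (gen_var (g i) < j)%N -> e i != 0%N ->
    absorbed (first_vars_ideal j) (\prod_i heis_gen q (g i) ^+ e i).
  move=> lt_j ei.
  exact: (absorbed_prod (F := fun i => heis_gen q (g i) ^+ e i) LM
    (mem_index_enum i) (gen_absorbed _ _ lt_j ei)).
rewrite /pbw /pbw_monomial.
case: (split_ordP v) lt_vj mv => [w ->|i ->]; first case: (split_ordP w) => i ->;
  move=> lt_j mi.
- rewrite -mulrA -[X in absorbed _ X]mul1r mulrA; apply: absorbedM => //.
  exact: (prod_absorbed (fun i => inr i) (fun i => m (zvar i)) i).
- apply: absorbedM => //.
  exact: (prod_absorbed (fun i => inl (inr i)) (fun i => m (yvar i)) i).
- rewrite -[X in absorbed _ X]mulr1; apply: absorbedM => //.
  exact: (prod_absorbed (fun i => inl (inl i)) (fun i => m (xvar i)) i).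
Qed.

Lemma first_vars_two_sided j : two_sided_ideal (first_vars_ideal j).
Proof.
have [[j0 jD] jM] := first_vars_left j; split=> // [a b ja jb|a r b jr].
  by rewrite -[a]scale1r; apply: jD.
rewrite -mulrA; apply: jM; rewrite -[r]heis_coordK /heis_of_coord /mlin mulr_suml.
rewrite big_seq_cond; apply: big_ind => [//|u v ju jv|m /andP[/jr mj _]].
  by rewrite -[u]scale1r; apply: jD.
by rewrite -scalerAl -[_ *: _]addr0; apply: jD => //; apply: pbw_absorbed.
Qed.

Lemma first_vars_not1 j : ~ first_vars_ideal j 1.
Proof.
have phi1 : phi 1 = 'X_[0] by rewrite (@heis_coord1 K n q q_neq0) mpolyX0.
move=> /(_ 0%MM); rewrite phi1 msuppX inE eqxx => /(_ isT)[v _].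
by rewrite mnm0E eqxx.
Qed.

(** Deleting from [a] the terms that lie in the ideal leaves a nonzero remainder [b], all of whose
    monomials avoid the first [j] variables. *)
Lemma first_vars_reduce j a : ~ first_vars_ideal j a ->
  exists b m, [/\ first_vars_ideal j (a - b), lead_at (phi b) m & ~ meets j m].
Proof.
move=> nja; pose c m := if `[< meets j m >] then 0 else (phi a)@_m.
pose p : P := \sum_(m <- msupp (phi a)) c m *: 'X_[m].
have pE k : p@_k = c k.
  rewrite /p raddf_sum /=; have [kp|kp] := boolP (k \in msupp (phi a)).
    rewrite (bigD1_seq k) ?msupp_uniq //= mcoeffZ mcoeffX eqxx mulr1.
    by rewrite big1 ?addr0 // => m /negPf mk; rewrite mcoeffZ mcoeffX mk mulr0.
  rewrite /c (memN_msupp_eq0 kp) if_same big_seq_cond big1 // => m /andP[mp _].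
  rewrite mcoeffZ mcoeffX; case: eqP => [mk|_]; last by rewrite mulr0.
  by rewrite mk (negPf kp) in mp.
have phip : phi (psi p) = p by rewrite heis_of_coordK.
have phiB : phi (a - psi p) = phi a - p.
  by have := heis_coord_linear q_neq0 (-1) (psi p) a; rewrite phip !scaleN1r !(addrC (- _)).
have jB : first_vars_ideal j (a - psi p).
  move=> m; rewrite phiB mcoeff_msupp mcoeffB pE /c.
  by case: asboolP => // _; rewrite subrr eqxx.
have p_neq0 : p != 0.
  apply: contra_not_neq nja => p0; move: jB; rewrite p0.
  by rewrite [psi 0](linear_fun0 (mlin_linear _)) subr0.
exists (psi p), (mlead p); split=> //; first by apply/lead_atP; rewrite phip.
by move: (mlead_supp p_neq0); rewrite mcoeff_msupp pE /c; case: asboolP; rewrite ?eqxx.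
Qed.

(** Reduce two elements outside the ideal to remainders avoiding the first [j] variables. The
    leading monomial of the product is the sum of theirs, so it avoids these variables too. *)
Lemma first_vars_prime j : prime_ideal (first_vars_ideal j).
Proof.
have jT := first_vars_two_sided j; have [[j0 jD] jM] := first_vars_left j.
apply: completely_prime => //; first exact: first_vars_not1.
move=> a b jab; apply: contrapT => /not_orP[nja njb].
have [a1 [m [ja1 am nm]]] := first_vars_reduce nja.
have [b1 [k [jb1 bk nk]]] := first_vars_reduce njb.
have j1 : first_vars_ideal j (a1 * b1).
  rewrite (mul_split a b a1 b1).
  apply: (jD); first exact: (two_sided_mulr b jT ja1).
  rewrite -[a * b]scale1r; apply: (jD); first exact: jab.
  by apply: (jD); [apply: (jM)|apply: (j0)].
have [ab0 _] := heis_coord_lead q_neq0 am bk.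
have /j1[v lt_v] : (m + k)%MM \in msupp (phi (a1 * b1)) by rewrite mcoeff_msupp.
rewrite mnmDE addn_eq0 negb_and => /orP[mv|kv]; [apply: nm|apply: nk]; by exists v.
Qed.

Lemma first_vars_chain : prime_chain N first_vars_ideal.
Proof.
split=> [j _|j lt_j]; first exact: first_vars_prime.
split=> [a ja m /ja[v lt_v mv]|le_j]; first by exists v => //; apply: ltnW.
have phiX : phi (psi 'X_[U_(Ordinal lt_j)]) = 'X_[U_(Ordinal lt_j)].
  by rewrite heis_of_coordK.
have /le_j : first_vars_ideal j.+1 (psi 'X_[U_(Ordinal lt_j)]).
  move=> m; rewrite phiX => /mem_msuppXP <-; exists (Ordinal lt_j) => //=.
  by rewrite mnm1E eqxx.
move=> /(_ U_(Ordinal lt_j)%MM); rewrite phiX msuppX inE eqxx => /(_ isT)[v lt_v].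
by rewrite mnm1E eqb0 negbK => /eqP vE; rewrite -vE /= ltnn in lt_v.
Qed.

End HeisenbergPrimes.

(** * Hilbert series *)

Section InverseSeries.

(** Moves one factor [1 - 'X] onto the series, where it acts as a backward difference. *)
Lemma fps_mul_1subX (h : fps) (p : {poly int}) :
  fps_mul h (fps_of_poly ((1 - 'X) * p)) =
  fps_mul (fun i => h i - (if i is j.+1 then h j else 0)) (fps_of_poly p).
Proof.
apply/funext => d; rewrite /fps_mul /fps_of_poly.
under eq_bigr do rewrite mulrBl mul1r coefB coefXM mulrBr.
under [RHS]eq_bigr do rewrite mulrBl.
rewrite !sumrB; congr (_ - _).
rewrite big_ord_recr /= subnn eqxx mulr0 addr0 [RHS]big_ord_recl mul0r add0r.
apply: eq_bigr => i _; rewrite subn_eq0 leqNgt ltn_ord /=.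
by congr (_ * p`_ _); rewrite /bump /=; have := ltn_ord i; lia.
Qed.

(** By Pascal's rule the backward difference in [d] of ['C(k.+1 + d, k.+1)] is ['C(k + d, k)]. *)
Lemma fps_mul_bin k :
  fps_mul (fun d => 'C(k + d, k)%:Z) (fps_of_poly ((1 - 'X) ^+ k.+1)) = fps_of_poly 1.
Proof.
elim: k => [|k IHk]; rewrite exprS fps_mul_1subX.
  apply/funext => d; rewrite /fps_mul /fps_of_poly expr0 big_ord_recl /= bin0 subn0 subr0 mul1r.
  by rewrite big1 ?addr0 // => i _; rewrite !bin0 subrr mul0r.
rewrite -IHk; congr (fps_mul _ _); apply/funext => -[|d].
  by rewrite !addn0 !binn subr0.
rewrite [(k.+1 + d.+1)%N]addnS binS PoszD addrC addKr.
by rewrite addSn addnS.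
Qed.

End InverseSeries.

Section HeisenbergDimensions.
Import mpoly.
Variables (K : fieldType) (n : nat) (q : K).
Hypothesis q_neq0 : q != 0.

Local Notation N := (n + n + n)%N.
Local Notation P := {mpoly K[N]}.
Local Notation H := (heis n q).
Local Notation phi := (@heis_coord K n q).
Local Notation psi := (@heis_of_coord K n q).

Definition exponent_mon (a b c : 'I_n -> nat) : 'X_{1..N} :=
  [multinom match split v with
            | inl w => match split w with inl i => a i | inr i => b i end
            | inr i => c i end | v < N].

Lemma exponent_mon_var (a b c : 'I_n -> nat) : ((forall i, exponent_mon a b c (zvar i) = a i) *
  (forall i, exponent_mon a b c (yvar i) = b i) *
  (forall i, exponent_mon a b c (xvar i) = c i))%type.
Proof.
split; first split; move=> i; rewrite mnmE.
- by rewrite (unsplitK (inl (lshift n i))) (unsplitK (inl i)).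
- by rewrite (unsplitK (inl (rshift n i))) (unsplitK (inr i)).
- by rewrite (unsplitK (inr i)).
Qed.

Lemma mdeg_vars (m : 'X_{1..N}) :
  mdeg m = (\sum_i (m (zvar i) + m (yvar i) + m (xvar i)))%N.
Proof. by rewrite mdegE !big_split_ord /= !big_split. Qed.

Lemma pbw_monomial_exponent a b c :
  pbw_monomial q a b c = pbw q (exponent_mon a b c).
Proof.
have aZ : (fun i => exponent_mon a b c (zvar i)) = a.
  by apply/funext => i; rewrite exponent_mon_var.
have bY : (fun i => exponent_mon a b c (yvar i)) = b.
  by apply/funext => i; rewrite exponent_mon_var.
have cX : (fun i => exponent_mon a b c (xvar i)) = c.
  by apply/funext => i; rewrite exponent_mon_var.
by rewrite /pbw aZ bY cX.
Qed.

Lemma heis_componentE d :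
  heis_component n q d = supported phi [set m | mdeg m = d].
Proof.
rewrite eqEsubset; split.
  apply: lspan_min; first exact/supported_submod/heis_coord_linear.
  move=> _ [a [b [c [abc ->]]]] m.
  rewrite pbw_monomial_exponent heis_coord_pbw // => /mem_msuppXP <- /=.
  rewrite mdeg_vars -abc; apply: eq_bigr => i _.
  by rewrite !exponent_mon_var.
move=> a da; rewrite -(heis_coordK a) /heis_of_coord /mlin big_seq_cond.
have [S0 SD] := lspan_submod [set m | exists a b c : 'I_n -> nat,
    (\sum_i (a i + b i + c i))%N = d /\ m = pbw_monomial q a b c].
apply: big_ind => [//|u v Su Sv|m /andP[/da dm _]].
  by rewrite -[u]scale1r; apply: SD.
rewrite -[_ *: _]addr0; apply: (SD) => //; apply: sub_lspan.
exists (fun i => m (zvar i)), (fun i => m (yvar i)), (fun i => m (xvar i)).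
by rewrite -mdeg_vars.
Qed.

Lemma heis_uptoE d : heis_upto n q d = filt phi d.
Proof.
have filt_submod : is_submod (filt phi d) by apply/supported_submod/heis_coord_linear.
rewrite eqEsubset; split.
  move=> _ [u [uc ->]]; have [F0 FD] := filt_submod.
  apply: big_ind => [//|a b Fa Fb|i _]; first by rewrite -[a]scale1r; apply: FD.
  have := uc i; rewrite heis_componentE => ui m /ui /= ->.
  by rewrite -ltnS.
move=> a da; pose part (i : nat) : P := \sum_(m <- msupp (phi a) | mdeg m == i) (phi a)@_m *: 'X_[m].
exists (fun i => psi (part i)); split=> [i|].
  rewrite heis_componentE => m; rewrite heis_of_coordK // => /msupp_sum_le.
  move=> /flattenP[s /mapP[k]]; rewrite mem_filter => /andP[/eqP ki _] ->.
  by move=> /msuppZ_le /mem_msuppXP <-.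
rewrite -[LHS]heis_coordK.
have -> : phi a = \sum_(i < d.+1) part i.
  rewrite [LHS]mpolyE /part (exchange_big_dep xpredT) //= [LHS]big_seq [RHS]big_seq.
  apply: eq_bigr => m /da /= dm.
  rewrite (bigD1 (Ordinal (dm : (mdeg m < d.+1)%N))) //= big1 ?addr0 // => i /andP[/eqP im].
  by case/eqP; apply: val_inj.
apply: (big_morph psi); last exact: linear_fun0 (mlin_linear _).
by move=> u v; rewrite -[u]scale1r [LHS]mlin_linear !scale1r.
Qed.

Lemma ldim_heis_component d k : N = k.+1 -> ldim (heis_component n q d) = 'C(k + d, k).
Proof.
move=> NE; rewrite heis_componentE.
have [b bB] := homogeneous_basis (@heis_coord_linear K n q q_neq0)
    (@heis_coordK K n q) (@heis_of_coordK K n q q_neq0) d NE.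
exact: ldimE bB.
Qed.

Lemma ldim_heis_upto d : ldim (heis_upto n q d) = 'C(N + d, N).
Proof.
rewrite heis_uptoE.
have [b bB] := filt_basis (@heis_coord_linear K n q q_neq0)
    (@heis_coordK K n q) (@heis_of_coordK K n q q_neq0) d.
exact: ldimE bB.
Qed.

End HeisenbergDimensions.

(** * Powers of generating subspaces *)

Section SubspacePowers.
Variables (K : fieldType) (A : algType K) (V : set A).

Lemma subspace_pow_submod d : is_submod (subspace_pow V d).
Proof. by case: d => [|d]; apply: lspan_submod. Qed.

Lemma subspace_powMl d v a : V v -> subspace_pow V d a -> subspace_pow V d.+1 (v * a).
Proof. by move=> Vv da; apply: sub_lspan; exists v, a. Qed.

Lemma subspace_pow0 : subspace_pow V 0 1.
Proof. exact: sub_lspan. Qed.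

Lemma sub_subspace_pow1 : V `<=` subspace_pow V 1.
Proof. by move=> v Vv; rewrite -[v]mulr1; apply: subspace_powMl => //; apply: subspace_pow0. Qed.

Lemma subspace_powD d e a b :
  subspace_pow V d a -> subspace_pow V e b -> subspace_pow V (d + e)%N (a * b).
Proof.
move=> da eb; have [E0 ED] := subspace_pow_submod (d + e).
pose U d := [set a | subspace_pow V (d + e)%N (a * b)].
have U_submod k : is_submod (U k).
  have [F0 FD] := subspace_pow_submod (k + e).
  split=> [|c u v Uu Uv]; rewrite /U /= ?mul0r //.
  by rewrite mulrDl -scalerAl; apply: FD.
suff /(_ a da) : subspace_pow V d `<=` U d by [].
elim: d {a da E0 ED} => [|d IHd]; apply: lspan_min => //.
  by move=> _ ->; rewrite /U /= mul1r.
move=> _ [u [v [Vu [/IHd Uv ->]]]].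
suff : subspace_pow V (d + e).+1 (u * (v * b)) by rewrite mulrA.
exact: subspace_powMl.
Qed.

Lemma subspace_pow_mono d e : V 1 -> (d <= e)%N -> subspace_pow V d `<=` subspace_pow V e.
Proof.
move=> V1 /subnKC <-; elim: (e - d)%N => [|k IHk]; first by rewrite addn0.
apply: subset_trans IHk _ => a ka; rewrite addnS -[a]mul1r.
exact: subspace_powMl.
Qed.

(** As [1] is in [V] the powers increase, so their union is a subalgebra containing [V]. *)
Lemma generating_subspace_pow : generating_subspace V ->
  forall a, exists d, subspace_pow V d a.
Proof.
case=> _ V1 Vgen; pose S : {pred A} := [pred a | `[< exists d, subspace_pow V d a >]].
have SP a : reflect (exists d, subspace_pow V d a) (a \in S) by apply: asboolP.
suff inS a : a \in S by move=> a; apply/SP.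
apply: (Vgen S) => [|v Vv]; last by apply/SP; exists 1%N; apply: sub_subspace_pow1.
split; first by apply/SP; exists 0%N; apply: subspace_pow0.
  move=> k u v /SP[d du] /SP[e ev]; apply/SP; exists (maxn d e).
  have [_ FD] := subspace_pow_submod (maxn d e); apply: FD.
    exact: (subspace_pow_mono V1 (leq_maxl d e) du).
  exact: (subspace_pow_mono V1 (leq_maxr d e) ev).
move=> u v /SP[d du] /SP[e ev]; apply/SP; exists (d + e)%N.
exact: subspace_powD.
Qed.

End SubspacePowers.

Section HeisenbergGrowth.
Import mpoly.
Variables (K : fieldType) (n : nat) (q : K).
Hypothesis q_neq0 : q != 0.

Local Notation N := (n + n + n)%N.
Local Notation P := {mpoly K[N]}.
Local Notation H := (heis n q).
Local Notation phi := (@heis_coord K n q).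
Local Notation psi := (@heis_of_coord K n q).
Local Notation filt := (filt phi).

Let phi_linear : linear phi. Proof. exact: heis_coord_linear. Qed.
Let phiK : cancel phi psi. Proof. exact: heis_coordK. Qed.
Let psiK : cancel psi phi. Proof. exact: heis_of_coordK. Qed.
Let phi1 : phi 1 = 1. Proof. exact: heis_coord1. Qed.
Let phi_lead a b m k : lead_at (phi a) m -> lead_at (phi b) k -> lead_at (phi (a * b)) (m + k)%MM.
Proof. exact: heis_coord_lead. Qed.

Lemma filt_submod d : is_submod (filt d).
Proof. exact: supported_submod. Qed.

Lemma subspace_pow_sub_filt (V : set H) : fin_ldim V ->
  exists l, forall d, subspace_pow V d `<=` filt (l * d)%N.
Proof.
move=> [m [b [b_span _]]].
have /choice[e be] : forall i, exists d, filt d (b i) by move=> i; apply: ex_filt.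
pose l := (\sum_i e i)%N; exists l.
have Vl : V `<=` filt l.
  rewrite -b_span; apply: lspan_min; first exact: filt_submod.
  move=> _ [i _ <-]; apply: filt_mono (be i).
  by rewrite /l (bigD1 i) //= leq_addr.
elim=> [|d IHd]; apply: lspan_min; try exact: filt_submod.
  by move=> _ ->; apply: filt1.
move=> _ [u [v [Vu [dv ->]]]]; rewrite mulnS.
by apply: (filtM phi_linear phiK phi_lead); [apply: Vl|apply: IHd].
Qed.

Lemma heis_gen_filt1 g : filt 1 (heis_gen q g).
Proof.
have gl : lead_at (phi (heis_gen q g * 1)) (U_(gen_var g) + 0)%MM.
  apply: lead_mul_gen => //; rewrite phi1 -mpolyX0 -[X in lead_at X]scale1r.
  by apply: lead_at_X; rewrite oner_neq0.
rewrite mulr1 addm0 in gl; have /lead_atP[g0 gm] := gl.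
by apply/filtE; rewrite -mlead_deg // gm mdeg1.
Qed.

Lemma pbw_subspace_pow (V : set H) k m : V 1 ->
  (forall g, subspace_pow V k (heis_gen q g)) -> subspace_pow V (k * mdeg m)%N (pbw q m).
Proof.
move=> V1 Vg; rewrite mdeg_vars !big_split /= !mulnDr /pbw /pbw_monomial.
have prodV (g : 'I_n -> 'I_n + 'I_n + 'I_n) (e : 'I_n -> nat) :
    subspace_pow V (k * \sum_i e i)%N (\prod_i heis_gen q (g i) ^+ e i).
  apply: (big_ind2 (fun j a => subspace_pow V (k * j)%N a)).
  - by rewrite muln0; apply: subspace_pow0.
  - by move=> j1 a1 j2 a2 ? ?; rewrite mulnDr; apply: subspace_powD.
  move=> i _; elim: (e i) => [|j IHj]; first by rewrite muln0; apply: subspace_pow0.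
  by rewrite exprS mulnS; apply: subspace_powD.
apply: subspace_powD; first apply: subspace_powD.
- exact: (prodV (fun i => inr i)).
- exact: (prodV (fun i => inl (inr i))).
- exact: (prodV (fun i => inl (inl i))).
Qed.

Lemma filt_sub_subspace_pow (V : set H) k : V 1 ->
  (forall g, subspace_pow V k (heis_gen q g)) ->
  forall d, filt d `<=` subspace_pow V (k * d)%N.
Proof.
move=> V1 Vg d a da; rewrite -(phiK a) /heis_of_coord /mlin big_seq_cond.
have [S0 SD] := subspace_pow_submod V (k * d)%N.
apply: big_ind => [//|u v Su Sv|m /andP[/da /= dm _]].
  by rewrite -[u]scale1r; apply: (SD).
rewrite -[_ *: _]addr0; apply: (SD) => //.
apply: (subspace_pow_mono V1 _ (pbw_subspace_pow m V1 Vg)).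
by rewrite leq_mul2l dm orbT.
Qed.

Lemma ex_generating_subspace : exists V : set H, generating_subspace V.
Proof.
exists (filt 1); split.
- have [b bB] := filt_basis phi_linear phiK psiK 1.
  by exists 'C(N + 1, N), b.
- exact: filt1.
move=> S [S1 SD SM] filtS a.
suff [d da] : exists d, subspace_pow (filt 1) d a.
  have S_submod : is_submod [set a | a \in S].
    split=> [|k u v]; last exact: SD.
    by rewrite /= -[0](addNr 1) -scaleN1r SD.
  suff sub : subspace_pow (filt 1) d `<=` [set a | a \in S] by apply: sub da.
  elim: d {da} => [|d IHd]; apply: lspan_min => //; first by move=> _ ->.
  by move=> _ [u [v [u1 [/IHd dv ->]]]]; apply: SM => //; apply: filtS.
have [d da] := ex_filt phi a; exists (1 * d)%N.
apply: filt_sub_subspace_pow da; first exact: filt1.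
by move=> g; apply/sub_subspace_pow1/heis_gen_filt1.
Qed.

Lemma subspace_pow_growth (V : set H) : generating_subspace V ->
  exists c C, (0 < C)%N /\ forall d, (0 < d)%N ->
    (d ^ N <= c * ldim (subspace_pow V d) /\ ldim (subspace_pow V d) <= C * d ^ N)%N.
Proof.
move=> Vgen; have [Vfin V1 _] := Vgen.
have [l Vl] := subspace_pow_sub_filt Vfin.
have /choice[e Ve] : forall g, exists d, subspace_pow V d (heis_gen q g).
  by move=> g; apply: generating_subspace_pow.
(* The sum bounds every [e g]; the successor keeps [k] positive for the division of [d] by [k]. *)
pose k := (\sum_g e g).+1.
have Vg g : subspace_pow V k (heis_gen q g).
  by apply: (subspace_pow_mono V1 _ (Ve g)); rewrite /k (bigD1 g) //= leqW ?leq_addr.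
(* Below: [filt (d %/ k)] lies in the [d]-th power, [d <= k * (d %/ k).+1], and [expn_le_bin] costs
   the factorial. Above: the power lies in [filt (l * d)], of dimension at most [(l * d).+1 ^ N],
   hence at most [(l.+1 * d) ^ N] for [d > 0]. *)
exists (k ^ N * N`!)%N, (l.+1 ^ N)%N; split=> [|d d_gt0]; first by rewrite expn_gt0.
have [b bB] := filt_basis phi_linear phiK psiK (l * d)%N.
have sub_b : subspace_pow V d `<=` lspan (range b) by rewrite bB.1; apply: Vl.
split; last first.
  apply: leq_trans (ldim_le (subspace_pow_submod V d) sub_b) _.
  apply: leq_trans (bin_le_expn _ _) _; rewrite -expnMn.
  by case: (N) => // M; rewrite leq_exp2r //; nia.
have [b' b'B] := filt_basis phi_linear phiK psiK (d %/ k)%N.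
have b'V i : subspace_pow V d (b' i).
  apply: (subspace_pow_mono V1 (leq_trunc_div d k)); rewrite mulnC.
  apply: (filt_sub_subspace_pow V1 Vg); rewrite -b'B.1.
  by apply: sub_lspan; exists i.
have le_dim := indep_ldim_le (subspace_pow_submod V d) sub_b b'V b'B.2.
rewrite -mulnA; apply: leq_trans (_ : k ^ N * (d %/ k).+1 ^ N <= _)%N.
  rewrite -expnMn; have : (d <= k * (d %/ k).+1)%N.
    by rewrite mulnC ltnW // -ltn_divLR // ltnSn.
  by case: (N) => // M; rewrite leq_exp2r.
rewrite leq_mul2l; apply/orP; right; apply: leq_trans (expn_le_bin _ _) _.
by rewrite leq_mul2l le_dim orbT.
Qed.

Lemma heis_prime_chain_le m (Pc : nat -> set H) : prime_chain m Pc -> (m <= N)%N.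
Proof. exact: (prime_chain_le phi_linear phiK psiK phi1 phi_lead). Qed.

End HeisenbergGrowth.

From mathcomp Require Import complex reals.
From mathcomp Require Import ereal topology normedtype sequences exp.

(** * Real asymptotics of binomial coefficients and of logarithmic quotients *)

Section Asymptotics.
Import numFieldNormedType.Exports.
Local Open Scope classical_set_scope.
Variable R : realType.

(** The binomial coefficient ['C(k + X, k)] as a polynomial in [X]. *)
Fixpoint bin_poly (k : nat) : {poly R} :=
  if k is l.+1 then l.+1%:R^-1 *: (('X + l.+1%:R%:P) * bin_poly l) else 1.

Lemma size_bin_poly k : size (bin_poly k) = k.+1.
Proof.
elim: k => [|k IHk]; first by rewrite size_poly1.
rewrite /= size_scale ?invr_eq0 ?pnatr_eq0 // size_mul.
- by rewrite size_XaddC IHk.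
- by rewrite -size_poly_eq0 size_XaddC.
- by rewrite -size_poly_eq0 IHk.
Qed.

Lemma horner_bin_poly k d : (bin_poly k).[d%:R] = 'C(k + d, k)%:R.
Proof.
elim: k => [|k IHk]; first by rewrite bin0 hornerC.
have XaddE : ('X + k.+1%:R%:P : {poly R}).[d%:R] = (k.+1 + d)%:R.
  by rewrite hornerD hornerX hornerC -natrD addnC.
by rewrite /= hornerZ hornerM IHk XaddE -natrM -bin_addS natrM mulKf.
Qed.

Lemma grows_like_poly_bin k : grows_like_poly R (fun d => 'C(k + d, k)) k.
Proof.
exists (bin_poly k); split; first exact: size_bin_poly.
apply: cvg_near_cst; apply: nearW => d.
by rewrite horner_bin_poly divff // pnatr_eq0 -lt0n bin_gt0 leq_addr.
Qed.

Lemma invr_ln_cvg0 : (ln d%:R : R)^-1 @[d --> \oo] --> (0 : R).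
Proof.
have ln_oo : (ln d%:R : R) @[d --> \oo] --> +oo.
  apply/cvgryPge => a; near=> d.
  rewrite -[a]expRK ler_ln ?posrE ?expR_gt0 //.
    by near: d; apply: nbhs_infty_ger.
  by rewrite ltr0n; near: d; apply: nbhs_infty_gt.
apply/gtr0_cvgV0 => //; near=> d.
by apply: ln_gt0; rewrite ltr1n; near: d; apply: nbhs_infty_gt.
Unshelve. all: by end_near. Qed.

(** Logarithms turn the multiplicative constants into errors [- ln c / ln d] and [ln C / ln d],
    which tend to 0; the quotient thus has a genuine limit. *)
Lemma limn_esup_log (f : nat -> nat) (k c C : nat) : (0 < C)%N ->
  (forall d, (0 < d)%N -> (d ^ k <= c * f d /\ f d <= C * d ^ k)%N) ->
  limn_esup (fun d => (ln (f d)%:R / ln d%:R : R)%:E) = k%:R%:E.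
Proof.
move=> C_gt0 f_bounds.
suff f_cvg : (ln (f d)%:R / ln d%:R : R) @[d --> \oo] --> (k%:R : R).
  have f_cvgE : (ln (f d)%:R / ln d%:R : R)%:E @[d --> \oo] --> (k%:R : R)%:E.
    by apply: cvg_EFin => //; apply: nearW.
  by have [_ ->] := cvg_limn_einf_sup f_cvgE.
have cvg_affine (a : R) : k%:R + a / ln d%:R @[d --> \oo] --> (k%:R : R).
  rewrite -[X in _ --> X]addr0 -(mulr0 a).
  apply: cvgD; first exact: cvg_cst.
  by apply: cvgM; [exact: cvg_cst|exact: invr_ln_cvg0].
apply: squeeze_cvgr (cvg_affine (- ln c%:R)) (cvg_affine (ln C%:R)).
near=> d; have d_gt1 : (1 < d)%N by near: d; apply: nbhs_infty_gt.
have d_gt0 := ltnW d_gt1.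
have [lo hi] := f_bounds d d_gt0.
have lnd : 0 < ln d%:R :> R by apply: ln_gt0; rewrite ltr1n.
(* The lower bound forces [c] and [f d] to be positive, so that their logarithms are not default
   values. *)
have : (0 < c * f d)%N by apply: leq_trans lo; rewrite expn_gt0 d_gt0.
rewrite muln_gt0 => /andP[c_gt0 fd_gt0].
have pos m : (0 < m)%N -> (m%:R : R) \in Num.pos by rewrite posrE ltr0n.
have ln_pow : ln (d ^ k)%:R = k%:R * ln d%:R :> R.
  by rewrite natrX lnXn ?ltr0n // mulr_natl.
have dk_gt0 : (0 < d ^ k)%N by rewrite expn_gt0 d_gt0.
have ln_le m m' : (0 < m)%N -> (m <= m')%N -> ln m%:R <= ln m'%:R :> R.
  by move=> m_gt0 mm'; rewrite ler_ln ?ler_nat ?pos // (leq_trans m_gt0).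
apply/andP; split.
  rewrite ler_pdivlMr // mulrDl divfK ?gt_eqF // -ln_pow lerBlDl.
  by rewrite -lnM ?pos // -natrM; apply: ln_le.
rewrite ler_pdivrMr // mulrDl divfK ?gt_eqF // -ln_pow addrC.
by rewrite -lnM ?pos // -natrM; apply: ln_le.
Unshelve. all: by end_near. Qed.

End Asymptotics.

(** * Hilbert series, growth and dimensions of the algebra *)

Section HeisenbergTheorem.
Variables (R : realType) (K : fieldType) (n : nat) (q : K).
Hypothesis q_neq0 : q != 0.
Local Notation H := (heis n q).

Lemma three_mul : (n + n + n)%N = (3 * n)%N.
Proof. by rewrite !mulSn addn0 addnA. Qed.

Lemma heis_hilbert_series : (0 < n)%N ->
  fps_mul (hilbert_series n q) (fps_of_poly ((1 - 'X) ^+ (3 * n))) = fps_of_poly 1.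
Proof.
move=> n_gt0; have [k kE] : exists k, (n + n + n)%N = k.+1.
  by exists (n + n + n).-1; rewrite prednK // addn_gt0 n_gt0 orbT.
rewrite -three_mul kE -(fps_mul_bin k); congr (fps_mul _ _); apply/funext => d.
by rewrite /hilbert_series (ldim_heis_component q_neq0 d kE).
Qed.

Lemma heis_polynomial_growth :
  grows_like_poly R (fun d => ldim (heis_upto n q d)) (3 * n).
Proof.
rewrite -three_mul; suff -> : (fun d => ldim (heis_upto n q d)) =
    (fun d => 'C((n + n + n) + d, n + n + n)) by apply: grows_like_poly_bin.
by apply/funext => d; rewrite ldim_heis_upto.
Qed.

Lemma heis_Krull_dim : classical_Krull_dim R H = (n + n + n)%:R%:E.
Proof.
apply/le_anti/andP; split.
  apply: ub_ereal_sup => _ [m [P Pm] <-].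
  by rewrite lee_fin ler_nat; apply: (heis_prime_chain_le q_neq0 Pm).
apply: ereal_sup_ubound; exists (n + n + n)%N => //.
by exists (first_vars_ideal (q := q)); apply: first_vars_chain.
Qed.

Lemma heis_GKdim : is_GKdim H ((n + n + n)%:R%:E : \bar R).
Proof.
split; first exact: ex_generating_subspace.
move=> V /(subspace_pow_growth q_neq0)[c [C [C_gt0 bounds]]].
exact: limn_esup_log C_gt0 bounds.
Qed.

End HeisenbergTheorem.

Lemma contains_complex_neq0 (R : realType) (q : R[i]) (K : fieldType) (qK : K) :
  contains_complex q qK -> q != 0 -> qK != 0.
Proof.
move=> [F [inC [inK [a <- <-]]]]; apply: contra_neq => /eqP.
by rewrite fmorph_eq0 => /eqP ->; rewrite rmorph0.
Qed.

Theorem theorem4p6 (R : realType) (n : nat) (q : R[i]) (K : fieldType) (qK : K)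
    (n_gt0 : (0 < n)%N) (q_neq0 : q != 0) (qKE : contains_complex q qK) :
  [/\ fps_mul (hilbert_series n qK) (fps_of_poly ((1 - 'X) ^+ (3 * n)))
        = fps_of_poly 1,
      grows_like_poly R (fun N => ldim (heis_upto n qK N)) (3 * n)
    & is_GKdim (heis n qK) (classical_Krull_dim R (heis n qK))].
Proof.
have qK_neq0 := contains_complex_neq0 qKE q_neq0.
split; first exact: heis_hilbert_series.
  exact: heis_polynomial_growth.
by rewrite heis_Krull_dim //; apply: heis_GKdim.
Qed.
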